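(* Let $r\ge 0$ be an integer, let $\lambda=(\lambda_0\ge\dots\ge\lambda_r)\in\mathbb Z^{r+1}$ and let $g\in GL_{r+1}(\mathbb C)$. Then for any $t\in\mathbb C$, $$\sum_{\sigma\in\mathfrak S_{r+1}}(-1)^\sigma g^{\sigma(\lambda+\rho_t)}=\chi_\lambda(g)\cdot\sum_{\sigma\in\mathfrak S_{r+1}}(-1)^\sigma g^{\sigma\rho_t};$$ equivalently, $$\bigwedge_{i=0}^{r} g^{\lambda_i+r/2-i+t}=\chi_\lambda(g)\cdot\bigwedge_{i=0}^{r} g^{r/2-i+t},$$ where the powers are defined using any (but always the same) value of $\log g$. When $\rho_t\in\mathbb Z^{r+1}$, the powers are single-valued (independent of the choice of $\log g$). In particular, for $t=r/2$, $$\bigwedge_{i=0}^{r} g^{\lambda_i+r-i}=\chi_\lambda(g)\cdot\bigwedge_{i=0}^{r} g^{r-i}.$$ When $\rho_t$ and $\lambda$ are both in $\mathbb Z_{\ge 0}^{r+1}$, the identities hold for every $g\in M_{r+1}(\mathbb C)$.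
   Context: $M_{r+1}(\mathbb C)$ is the space of complex $(r+1)\times(r+1)$ matrices. The maximal torus of $GL_{r+1}(\mathbb C)$ is the group of invertible diagonal matrices, its weight lattice is identified with $\mathbb Z^{r+1}$ (the weight $\lambda$ corresponds to the character $\mathrm{diag}(z_0,\dots,z_r)\mapsto\prod_i z_i^{\lambda_i}$), and dominant weights are those with $\lambda_0\ge\dots\ge\lambda_r$. For dominant $\lambda$, $\chi_\lambda:GL_{r+1}(\mathbb C)\to\mathbb C$ is the character of the irreducible rational representation of highest weight $\lambda$. When $\lambda\in\mathbb Z_{\ge0}^{r+1}$, $\chi_\lambda$ is the restriction of a unique polynomial function on $M_{r+1}(\mathbb C)$, also denoted $\chi_\lambda$. $\rho=\left(\frac r2,\frac{r-2}2,\dots,\frac{2-r}2,\frac{-r}2\right)$ is the half-sum of the positive roots and $\rho_t=\rho+(t,t,\dots,t)$ for $t\in\mathbb C$. The symmetric group $\mathfrak S_{r+1}$ (the Weyl group) acts on $\mathbb C^{r+1}$ by permuting coordinates, and $(-1)^\sigma$ is the sign of $\sigma$. A value of $\log g$ is a matrix $X\in\mathfrak{gl}_{r+1}(\mathbb C)$ with $\exp X=g$; given this choice, $g^{s}=\exp(sX)$ for $s\in\mathbb C$. For $\ell\in\mathbb C^{r+1}$, $g^\ell=g^{\ell_0}\otimes g^{\ell_1}\otimes\dots\otimes g^{\ell_r}\in M_{r+1}(\mathbb C)^{\otimes(r+1)}$. For $\ell\in\mathbb Z^{r+1}$ these are ordinary integer powers, and for $\ell\in\mathbb Z_{\ge0}^{r+1}$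 they are defined for every $g\in M_{r+1}(\mathbb C)$ (with $g^0=\mathbf 1$). The wedge product is the antisymmetrized tensor $\bigwedge_{i=0}^r A_i=\sum_{\sigma\in\mathfrak S_{r+1}}(-1)^\sigma A_{\sigma(0)}\otimes\dots\otimes A_{\sigma(r)}$, where the factors are elements of the vector space $M_{r+1}(\mathbb C)$; thus $\bigwedge_{i=0}^r g^{\ell_i}=\sum_{\sigma}(-1)^\sigma g^{\sigma\ell}$. *)

(* Defs.v *)
From HB Require Import structures.
From mathcomp Require Import all_boot all_order fingroup perm all_algebra.
From mathcomp Require Import complex.
From mathcomp Require mpoly.
From mathcomp Require Import all_classical all_reals all_analysis.

Set Implicit Arguments.
Unset Strict Implicit.
Unset Printing Implicit Defensive.

Import Order.TTheory GRing.Theory Num.Theory.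
Import numFieldNormedType.Exports.

Local Open Scope classical_set_scope.
Local Open Scope ring_scope.
Local Open Scope complex_scope.

Section MatrixPowers.
Variables (R : realType) (r : nat).
Local Notation C := R[i].
Local Notation M := 'M[C]_r.+1.

Definition mexp (X : M) : M :=
  limn (series (fun k : nat => (k`!%:R : C)^-1 *: X ^+ k)).

Definition is_log (X g : M) : Prop := mexp X = g.

(* [cpow X s] is the power [g ^ s] relative to the value [X] of [log g]. *)
Definition cpow (X : M) (s : C) : M := mexp (s *: X).

(* The (r+1)-fold tensor power of the space of matrices, in coordinates: the
   multi-index [f] stands for the basis tensor
   E_(f 0) (x) ... (x) E_(f r), where E_(a, b) is a matrix unit. *)
Local Notation tens := {ffun {ffun 'I_r.+1 -> 'I_r.+1 * 'I_r.+1} -> C^o}.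

Definition ptens (A : 'I_r.+1 -> M) : tens :=
  [ffun f : {ffun 'I_r.+1 -> 'I_r.+1 * 'I_r.+1} =>
     \prod_i A i (f i).1 (f i).2].

Definition wedge (A : 'I_r.+1 -> M) : tens :=
  \sum_(s : 'S_r.+1) (-1 : C) ^+ s *: ptens (fun i => A (s i)).

Definition tens_cpow (X : M) (l : 'I_r.+1 -> C) : tens :=
  ptens (fun i => cpow X (l i)).

(* For [l i = Posz n] the power [g ^ l i] is [g ^+ n], also for singular [g]. *)
Definition tens_ipow (g : M) (l : 'I_r.+1 -> int) : tens :=
  ptens (fun i => g ^ l i).

Definition perm_coord (T : Type) (s : 'S_r.+1) (l : 'I_r.+1 -> T) :
  'I_r.+1 -> T := fun i => l (s i).

Definition rho (i : 'I_r.+1) : C := (r%:R - 2 * i%:R) / 2.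

Definition rho_shift (t : C) (i : 'I_r.+1) : C := rho i + t.

End MatrixPowers.

Section Characters.
Variables (R : realType) (r : nat).
Local Notation C := R[i].
Local Notation M := 'M[C]_r.+1.

Definition polynomial_function (f : M -> C) : Prop :=
  exists p : mpoly.mpoly (r.+1 * r.+1) C,
    forall g, f g = mpoly.meval (fun k => mxvec g ord0 k) p.

Definition dominant (lam : 'I_r.+1 -> int) : Prop :=
  forall i j : 'I_r.+1, (i <= j)%N -> lam j <= lam i.

Section Representation.
Variables (N : nat) (V : M -> 'M[C]_N).

(* Column vectors: letting [V g] act on row vectors from the right would give
   the dual highest weight. The values of [V] off [unitmx] are irrelevant. *)
Definition representation : Prop :=
  V 1%:M = 1%:M /\
  {in unitmx &, forall g h : M, V (g *m h) = V g *m V h}.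

(* The coordinate ring of GL is C[x_ij][1/det]. *)
Definition rational : Prop :=
  forall a b : 'I_N, exists (f : M -> C) (k : nat), polynomial_function f /\
    {in unitmx, forall g : M, V g a b = f g / \det g ^+ k}.

Definition irreducible : Prop :=
  (0 < N)%N /\
  forall W : {vspace 'cV[C]_N},
    {in unitmx, forall (g : M) (v : 'cV[C]_N), v \in W -> V g *m v \in W} ->
    W = 0%VS \/ W = fullv.

Definition weight_vector (lam : 'I_r.+1 -> int) (v : 'cV[C]_N) : Prop :=
  forall z : 'rV[C]_r.+1, (forall i, z 0 i != 0) ->
    V (diag_mx z) *m v = (\prod_i z 0 i ^ lam i) *: v.

Definition upper_unitriangular (u : M) : Prop :=
  is_trig_mx u^T /\ forall i, u i i = 1.

Definition highest_weight (lam : 'I_r.+1 -> int) : Prop :=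
  exists v : 'cV[C]_N, [/\ v != 0, weight_vector lam v &
    forall u, upper_unitriangular u -> V u *m v = v].

End Representation.

Definition irr_character (lam : 'I_r.+1 -> int) (chi : M -> C) : Prop :=
  exists (N : nat) (V : M -> 'M[C]_N),
    [/\ representation V, rational V, irreducible V, highest_weight V lam &
        {in unitmx, forall g : M, chi g = \tr (V g)}].

End Characters.

(* Main.v *)
(* The heart of the matter is Weyl's character formula on the torus. After
   twisting by a power of det, the representation V is polynomial, hence
   multiplicative on all matrices and differentiable algebraically along
   the lines 1 + 'X * X. The Casimir element acts on V by the scalar
   |lam + rho|^2 - |rho|^2. Computing tr(V(z) Casimir) from the commutation
   of V(z) with root vectors shows that the product of the Vandermonde
   determinant and the character is an eigenfunction of the Laplacian of the
   torus, so only monomials z^mu with |mu| = |lam + rho| occur in it. All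
   weights are dominated by lam, because the lower unitriangular orbit of the
   highest weight vector spans V (density of the big cell); hence mu is a
   permutation of lam + rho, and the product is the alternant of lam + rho.

   For g = P diag(z) P^-1, each coordinate of a wedge of powers of g is the
   determinant of a product of two matrices, one depending on P only, the
   other being the alternant matrix; so the torus formula gives the identity
   for diagonalizable g. It extends to all g by density, and to complex
   exponents because multiplying every factor of a wedge by the same matrix
   preserves proportionality. *)

Require Import Defs.
From mathcomp Require Import all_boot all_order fingroup perm all_algebra.
From mathcomp Require Import complex ring zify.
From mathcomp Require mpoly.
From mathcomp Require Import all_classical all_reals all_analysis.
Set Implicit Arguments.
Unset Strict Implicit.
Unset Printing Implicit Defensive.
Import Order.TTheory GRing.Theory Num.Theory.
Local Open Scope ring_scope.
Local Open Scope complex_scope.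

(** * Polynomial maps between matrix spaces and their differentials *)

(* Polynomial expressions, so that one polynomial can be evaluated both over the
   base field and over polynomials in the parameter of a curve. *)
Inductive pexp (K I : Type) : Type :=
  | PConst of K
  | PVar of I
  | PAdd of pexp K I & pexp K I
  | PMul of pexp K I & pexp K I.

Fixpoint peval (K I : Type) (A : comNzRingType) (h : K -> A) (v : I -> A)
    (e : pexp K I) : A :=
  match e with
  | PConst c => h c
  | PVar i => v i
  | PAdd e1 e2 => peval h v e1 + peval h v e2
  | PMul e1 e2 => peval h v e1 * peval h v e2
  end.

Arguments PVar {K I}.

Lemma peval_rmorph (K I : Type) (A B : comNzRingType) (f : {rmorphism A -> B})
    (h : K -> A) (v : I -> A) (e : pexp K I) :
  f (peval h v e) = peval (f \o h) (f \o v) e.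
Proof.
by elim: e => //= e1 IH1 e2 IH2; rewrite (rmorphD, rmorphM) IH1 IH2.
Qed.

Lemma eq_peval (K I : Type) (A : comNzRingType) (h h' : K -> A) (v v' : I -> A)
    (e : pexp K I) : h =1 h' -> v =1 v' -> peval h v e = peval h' v' e.
Proof. by move=> hh vv; elim: e => //= e1 -> e2 ->. Qed.

(** * Polynomial identities checked at generic parameters *)

Section PolyDensity.
Variable F : numFieldType.

Lemma poly_eq0_fun (p : {poly F}) : (forall x, p.[x] = 0) -> p = 0.
Proof.
move=> p0; apply/eqP/negPn/negP => pN0.
have := @max_poly_roots _ p [seq k%:R : F | k <- iota 0 (size p)] pN0.
rewrite size_map size_iota ltnn => H; apply: (negP (isT : ~~ false)); apply: H.
  by apply/allP => x _; apply/eqP.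
by rewrite map_inj_uniq ?iota_uniq// => a b /eqP; rewrite eqr_nat => /eqP.
Qed.

(** The product [p * q] vanishes everywhere, hence is zero, and [{poly F}] is a domain. This is the
    density argument behind the later passages from generic to arbitrary matrices. *)
Lemma poly_eq0_generic (p q : {poly F}) : q != 0 ->
  (forall x, q.[x] != 0 -> p.[x] = 0) -> p = 0.
Proof.
move=> qN0 H; apply/eqP; have: p * q == 0.
  apply/eqP/poly_eq0_fun => x; rewrite hornerM.
  by have [->|/H->] := eqVneq q.[x] 0; rewrite (mulr0, mul0r).
by rewrite mulf_eq0 (negPf qN0) orbF.
Qed.

Definition evmx m n (x : F) (P : 'M[{poly F}]_(m, n)) : 'M[F]_(m, n) :=
  map_mx (horner_eval x) P.

Lemma polymx_generic m n (P Q : 'M[{poly F}]_(m, n)) (q : {poly F}) : q != 0 ->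
  (forall x, q.[x] != 0 -> evmx x P = evmx x Q) -> P = Q.
Proof.
move=> qN0 H; apply/matrixP => i j; apply/eqP; rewrite -subr_eq0; apply/eqP.
apply: poly_eq0_generic qN0 _ => x /H /matrixP/(_ i j).
by rewrite !mxE /horner_eval hornerD hornerN => ->; rewrite subrr.
Qed.

Lemma polymx_eq m n (P Q : 'M[{poly F}]_(m, n)) :
  (forall x, evmx x P = evmx x Q) -> P = Q.
Proof. by move=> H; apply: (@polymx_generic _ _ _ _ 1) => //; apply: oner_neq0. Qed.

(** Its determinant is the characteristic polynomial of [- g], hence nonzero: the line deforms [g]
    into invertible matrices. *)
Definition shiftp n (g : 'M[F]_n) : 'M[{poly F}]_n := map_mx polyC g + 'X%:M.

Lemma evmxC m n x (g : 'M[F]_(m, n)) : evmx x (map_mx polyC g) = g.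
Proof. by apply/matrixP => i j; rewrite !mxE /horner_eval hornerC. Qed.

Lemma evmx_shiftp n x (g : 'M[F]_n) : evmx x (shiftp g) = g + x%:M.
Proof.
by apply/matrixP => i j; rewrite !mxE /horner_eval hornerD hornerC hornerMn hornerX.
Qed.

Lemma det_evmx n x (P : 'M[{poly F}]_n) : \det (evmx x P) = (\det P).[x].
Proof. by rewrite det_map_mx. Qed.

Lemma det_shiftp_neq0 n (g : 'M[F]_n) : \det (shiftp g) != 0.
Proof.
have ->: shiftp g = char_poly_mx (- g).
  by rewrite /char_poly_mx /shiftp map_mxN opprK addrC.
exact/monic_neq0/char_poly_monic.
Qed.

Lemma unitmx_shift n x (g : 'M[F]_n) :
  (\det (shiftp g)).[x] != 0 -> g + x%:M \in unitmx.
Proof. by rewrite -det_evmx evmx_shiftp unitmxE unitfE. Qed.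

End PolyDensity.

(** * Multiplicative polynomial maps and their differentials at the identity *)

Section PolyMaps.
Variable F : numFieldType.
Variables (n N : nat) (e : 'I_N -> 'I_N -> pexp F ('I_n * 'I_n)).

Definition pmx (g : 'M[F]_n) : 'M[F]_N :=
  \matrix_(a, b) peval id (fun p => g p.1 p.2) (e a b).

Definition pmxX (G : 'M[{poly F}]_n) : 'M[{poly F}]_N :=
  \matrix_(a, b) peval polyC (fun p => G p.1 p.2) (e a b).

Lemma evmx_pmxX x G : evmx x (pmxX G) = pmx (evmx x G).
Proof.
apply/matrixP => a b; rewrite !mxE (peval_rmorph (horner_eval x)).
by apply: eq_peval => [c|p] /=; rewrite ?mxE // /horner_eval hornerC.
Qed.

Lemma pmxX_const g : pmxX (map_mx polyC g) = map_mx polyC (pmx g).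
Proof. by apply: polymx_eq => x; rewrite evmx_pmxX !evmxC. Qed.

Definition cong2 m k (P Q : 'M[{poly F}]_(m, k)) :=
  forall i j, (P i j)`_0 = (Q i j)`_0 /\ (P i j)`_1 = (Q i j)`_1.

Lemma pmxX_cong2 G H : cong2 G H -> cong2 (pmxX G) (pmxX H).
Proof.
move=> GH i j; rewrite !mxE; elim: (e i j) => //= e1 [a0 a1] e2 [b0 b1].
  by rewrite !coefD a0 a1 b0 b1.
by rewrite !coefM !big_ord_recl !big_ord0 /= a0 a1 b0 b1.
Qed.

Hypothesis pmx1 : pmx 1%:M = 1%:M.
Hypothesis pmxM_unit :
  {in unitmx &, forall g h, pmx (g *m h) = pmx g *m pmx h}.

(** Along the lines [g + x 1] and [h + x 1] both sides are polynomial in [x] and agree wherever the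
    two matrices are invertible, hence also at [x = 0]. *)
Lemma pmxM g h : pmx (g *m h) = pmx g *m pmx h.
Proof.
pose G := shiftp g; pose H := shiftp h.
have: pmxX (G *m H) = pmxX G *m pmxX H.
  apply: (@polymx_generic _ _ _ _ _ (\det G * \det H)).
    by rewrite mulf_neq0 ?det_shiftp_neq0.
  move=> x; rewrite hornerM mulf_eq0 negb_or => /andP[xG xH].
  rewrite /evmx map_mxM -!/(evmx _ _) !evmx_pmxX /evmx map_mxM -!/(evmx _ _).
  by rewrite pmxM_unit// evmx_shiftp unitmx_shift.
move/(congr1 (evmx 0)); rewrite /evmx map_mxM -!/(evmx _ _) !evmx_pmxX /evmx map_mxM.
by rewrite -!/(evmx _ _) !evmx_shiftp !(raddf0 (@scalar_mx _ _)) !addr0.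
Qed.

Lemma pmxXM G H : pmxX (G *m H) = pmxX G *m pmxX H.
Proof.
apply: polymx_eq => x; rewrite /evmx map_mxM -!/(evmx _ _) !evmx_pmxX.
by rewrite /evmx map_mxM pmxM.
Qed.

Definition dcoef m k (P : 'M[{poly F}]_(m, k)) : 'M[F]_(m, k) :=
  map_mx (coefp 1) P.

Definition tline (X : 'M[F]_n) : 'M[{poly F}]_n :=
  1%:M + 'X *: map_mx polyC X.

(** The differential of [pmx] at the identity, that is, the induced action of the Lie algebra of
    matrices. *)
Definition dpmx (X : 'M[F]_n) : 'M[F]_N := dcoef (pmxX (tline X)).

Lemma evmx_tline x X : evmx x (tline X) = 1%:M + x *: X.
Proof.
apply/matrixP => i j; rewrite !mxE /horner_eval !hornerE hornerMn hornerC.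
by [].
Qed.

Lemma dpmx_cong2 G X : cong2 G (tline X) -> dcoef (pmxX G) = dpmx X.
Proof.
move=> /pmxX_cong2 H; apply/matrixP => i j.
by rewrite !mxE; have [_ ] := H i j; rewrite !mxE.
Qed.

Lemma dcoefM m k l (P : 'M[{poly F}]_(m, k)) (Q : 'M[{poly F}]_(k, l)) :
  dcoef (P *m Q) = dcoef P *m evmx 0 Q + evmx 0 P *m dcoef Q.
Proof.
apply/matrixP => i j; rewrite !mxE raddf_sum -big_split /=.
apply: eq_bigr => a _; rewrite !mxE /coefp /= /horner_eval !horner_coef0.
by rewrite coefM !big_ord_recl big_ord0 /= addr0 addrC.
Qed.

Lemma dcoefC m k (P : 'M[F]_(m, k)) : dcoef (map_mx polyC P) = 0.
Proof. by apply/matrixP => i j; rewrite !mxE /= coefC. Qed.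

Lemma pmx_ev0_tline X : evmx 0 (pmxX (tline X)) = 1%:M.
Proof. by rewrite evmx_pmxX evmx_tline scale0r addr0 pmx1. Qed.

(** Modulo the square of the parameter, [1 + t(X + Y)] is the product [(1 + tX)(1 + tY)], to which
    multiplicativity and the Leibniz rule apply. *)
Lemma dpmxD X Y : dpmx (X + Y) = dpmx X + dpmx Y.
Proof.
rewrite -(@dpmx_cong2 (tline X *m tline Y)).
  by rewrite pmxXM dcoefM !pmx_ev0_tline mulmx1 mul1mx.
rewrite /tline !mulmxDl !mulmxDr !mul1mx mulmx1 -scalemxAl -scalemxAr -map_mxM.
move=> i j; rewrite map_mxD scalerDr.
split; rewrite !mxE !coefD !coefXM /= ?coefXM /=.
  by rewrite !addr0.
by rewrite !addr0 -addrA [_ + (X i j)%:P`_0]addrC.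
Qed.

Lemma dpmxZ c X : dpmx (c *: X) = c *: dpmx X.
Proof.
have E: pmxX (tline (c *: X)) = map_mx (comp_poly (c *: 'X)) (pmxX (tline X)).
  apply/matrixP => a b; rewrite !mxE (peval_rmorph (comp_poly (c *: 'X))).
  apply: eq_peval => [u|p] /=; first by rewrite comp_polyC.
  rewrite !mxE comp_polyD comp_polyM comp_polyX comp_polyC.
  rewrite rmorphMn /= polyCM -!mul_polyC rmorph1; congr (_ + _).
  by rewrite mulrA [_ * 'X]mulrC.
apply/matrixP => a b; rewrite /dpmx E !mxE /=.
set p := peval _ _ _.
have coefE (q : {poly F}) : q`_1 = (q^`()).[0] by rewrite horner_coef0 coef_deriv mulr1n.
rewrite !coefE deriv_comp derivZ derivX hornerM horner_comp !hornerE ?mulr0.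
by rewrite /= mulr1 mulrC.
Qed.

Lemma dpmx_sum (I : Type) (s : seq I) (P : pred I) (X : I -> 'M[F]_n) :
  dpmx (\sum_(i <- s | P i) X i) = \sum_(i <- s | P i) dpmx (X i).
Proof.
have d0: dpmx 0 = 0 by rewrite -(scale0r (0 : 'M[F]_n)) dpmxZ scale0r.
by elim/big_rec2: _ => // i x y _ <-; rewrite dpmxD.
Qed.

(** Differentiate [g (1 + tX) = (1 + tY) g]. The intertwining form involves no inverse, so [g] may
    be singular. *)
Lemma dpmx_conj g X Y : g *m X = Y *m g -> pmx g *m dpmx X = dpmx Y *m pmx g.
Proof.
move=> gXY; have E: map_mx polyC g *m tline X = tline Y *m map_mx polyC g.
  by rewrite mulmxDl mulmxDr mulmx1 mul1mx -scalemxAr -scalemxAl -!map_mxM gXY.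
have := congr1 (@dcoef _ _) (congr1 pmxX E).
rewrite !pmxXM !dcoefM pmxX_const dcoefC mul0mx add0r mulmx0 addr0.
by rewrite evmxC.
Qed.

(** Since [X] has square zero, [1 + xX] has inverse [1 - xX] and conjugates [Y] to [Y + x [X, Y] -
    x^2 XYX], a polynomial in [x]. Comparing the coefficients of [x] after applying the
    representation gives the bracket. *)
Lemma dpmx_bracket X Y : X *m X = 0 ->
  dpmx X *m dpmx Y = dpmx Y *m dpmx X + dpmx (X *m Y - Y *m X).
Proof.
move=> X0; have [W WE]: exists W, W = X *m Y - Y *m X by exists (X *m Y - Y *m X).
rewrite -WE; have E: pmxX (tline X) *m map_mx polyC (dpmx Y) =
    (map_mx polyC (dpmx Y) + 'X *: map_mx polyC (dpmx W)
     - 'X ^+ 2 *: map_mx polyC (dpmx (X *m Y *m X))) *m pmxX (tline X).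
  apply: polymx_eq => x; rewrite /evmx !map_mxM -!/(evmx _ _) evmx_pmxX evmx_tline.
  rewrite evmxC (@dpmx_conj _ _ (Y + x *: W - x ^+ 2 *: (X *m Y *m X))).
    rewrite -scaleNr !dpmxD !dpmxZ scaleNr; congr (_ *m _).
    move: (dpmx Y) (dpmx W) (dpmx _) => A B D; apply/matrixP => i j.
    by rewrite !mxE /horner_eval !hornerE.
  rewrite !(mulmxDl, mulmxDr, mulmx1, mul1mx, mulNmx) -!(scalemxAl, scalemxAr) WE.
  rewrite -!mulmxA X0 !mulmx0 !scaler0 oppr0 addr0.
  rewrite scalerBr !mulmxBl -!mulmxA X0 mulmx0 subr0 scalerA -expr2.
  move: (X *m Y) (Y *m X) (X *m _) => A B D; apply/matrixP => i j.
  by rewrite !mxE; ring.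
have := congr1 (@dcoef _ _) E.
rewrite !dcoefM dcoefC mulmx0 addr0 evmxC pmx_ev0_tline mulmx1 addrC -/(dpmx X).
move=> ->; move: (dpmx (X *m Y *m X)) => D.
have ->: evmx 0 (map_mx polyC (dpmx Y) + 'X *: map_mx polyC (dpmx W)
    - 'X ^+ 2 *: map_mx polyC D) = dpmx Y.
  move: (dpmx Y) (dpmx W) => A B; apply/matrixP => i j.
  by rewrite !mxE /horner_eval !hornerE expr0n /= ?mul0r ?subr0 ?addr0.
congr (_ + _).
move: (dpmx Y) (dpmx W) => A B; apply/matrixP => i j.
by rewrite !mxE /= !coefD coefN coefXM coefXnM !coefC /= subr0 add0r.
Qed.

End PolyMaps.

(** * Weights of a polynomial representation *)

Lemma coef1_exp1X (R : nzRingType) k : ((1 + 'X) ^+ k : {poly R})`_1 = k%:R.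
Proof.
rewrite addrC exprDn_comm; last exact: commr1.
rewrite coef_sum; case: k => [|k].
  by rewrite big_ord1 /= !expr1n mulr1 expr0 mulr1n coefC.
rewrite (bigD1 (inord k)) //= inordK // big1 ?addr0.
  by rewrite expr1n mulr1 subSnn expr1 coefMn coefX /= binSn.
move=> j jN; rewrite expr1n mulr1 coefMn coefXn.
case: eqP => [jE|]; last by rewrite mul0rn.
case/eqP: jN; apply/val_inj; rewrite /= inordK //.
have := ltn_ord j; lia.
Qed.

(** * Independence of the characters of the torus *)

Section Monomials.
Variables (F : numFieldType) (n : nat).
Local Notation expo := {ffun 'I_n -> nat}.

Definition mono (z : 'rV[F]_n) (m : expo) : F := \prod_i z 0 i ^+ m i.

Definition nonzero (z : 'rV[F]_n) := forall i, z 0 i != 0.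

Definition hadamard (z w : 'rV[F]_n) : 'rV[F]_n := \row_i (z 0 i * w 0 i).

Lemma mono_hadamard z w m : mono (hadamard z w) m = mono z m * mono w m.
Proof. by rewrite -big_split; apply: eq_bigr => i _; rewrite mxE exprMn. Qed.

Lemma mono_add z (m k : expo) : mono z [ffun i => m i + k i]%N = mono z m * mono z k.
Proof. by rewrite -big_split; apply: eq_bigr => i _; rewrite ffunE exprD. Qed.

Lemma mono_const1 m : mono (const_mx 1) m = 1.
Proof. by rewrite /mono big1 // => i _; rewrite mxE expr1n. Qed.

(* Dedekind's independence of characters, for the characters [z |-> z^m]. *)
Lemma mono_free (s : seq expo) (c : expo -> F) : uniq s ->
  (forall z, nonzero z -> \sum_(m <- s) c m * mono z m = 0) ->
  {in s, forall m, c m = 0}.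
Proof.
elim: s c => // a s IH c /= /andP[aNs us] H.
have c0 : {in s, forall m, c m = 0}.
  move=> m ms; have /forallPn[i aim] : ~~ [forall i, a i == m i].
    by apply: contra aNs => /eqfunP E; rewrite (_ : a = m) //; apply/ffunP.
  (* At [w] the characters of [m] and [a] take the distinct values [2 ^+ m i] and [2 ^+ a i].
     Subtracting [mono w a] times the relation from its translate by [w] eliminates [a]. *)
  pose w : 'rV[F]_n := \row_j if j == i then 2 else 1.
  have w0 : nonzero w by move=> j; rewrite mxE; case: (j == i); rewrite ?pnatr_eq0 ?oner_eq0.
  have wE k : mono w k = 2 ^+ k i.
    rewrite /mono (bigD1 i) //= mxE eqxx big1 ?mulr1 // => j jNi.
    by rewrite mxE (negPf jNi) expr1n.
  have /eqP : c m * (mono w m - mono w a) = 0.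
    apply: (IH (fun m => c m * (mono w m - mono w a)) us _ m ms) => z z0.
    have zw0 : nonzero (hadamard z w) by move=> j; rewrite mxE mulf_neq0 ?z0 ?w0.
    transitivity (\sum_(k <- a :: s) c k * mono (hadamard z w) k
        - mono w a * \sum_(k <- a :: s) c k * mono z k); last first.
      by rewrite !H // mulr0 subrr.
    rewrite big_distrr /= -sumrB big_cons /= mono_hadamard.
    rewrite [X in _ = X + _](_ : _ = 0) ?add0r; last by ring.
    by apply: eq_bigr => k _; rewrite mono_hadamard /=; ring.
  rewrite mulf_eq0 subr_eq0 !wE => /orP[/eqP//|/eqP].
  have lt02 : 0 < 2 :> F by rewrite ltr0n.
  have n21 : 2 != 1 :> F by rewrite (eqr_nat _ 2 1).
  by move/(ieexprIn lt02 n21)/esym/eqP; rewrite (negPf aim).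
move=> m; rewrite inE => /orP[/eqP->|/c0//].
have := H (const_mx 1); rewrite big_cons big1_seq ?addr0.
  by rewrite mono_const1 mulr1; apply=> i; rewrite mxE oner_neq0.
by move=> k /= /c0->; rewrite mul0r.
Qed.

End Monomials.

Section Expansion.
Variables (F : numFieldType) (n : nat).
Local Notation expo := {ffun 'I_n -> nat}.

(** Uncollected terms of the restriction to diagonal matrices; an off-diagonal variable yields a
    term with coefficient 0. *)
Fixpoint pexpand (e : pexp F ('I_n * 'I_n)) : seq (F * expo) :=
  match e with
  | PConst c => [:: (c, [ffun=> 0%N])]
  | PVar p => [:: ((p.1 == p.2)%:R, [ffun i => nat_of_bool (i == p.1)])]
  | PAdd e1 e2 => pexpand e1 ++ pexpand e2
  | PMul e1 e2 => [seq (s.1 * t.1, [ffun i => s.2 i + t.2 i]%N)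
                    | s : F * expo <- pexpand e1, t : F * expo <- pexpand e2]
  end.

Lemma pexpandE e z : peval id (fun p => diag_mx z p.1 p.2) e =
  \sum_(t <- pexpand e) t.1 * mono z t.2.
Proof.
elim: e => /= [c|p|e1 -> e2 ->|e1 -> e2 ->].
- rewrite big_seq1 /= /mono big1 ?mulr1 // => i _.
  by rewrite ffunE expr0.
- rewrite big_seq1 /= mxE /mono (bigD1 p.1) //= ffunE eqxx expr1 big1.
    by rewrite mulr1 mulr_natl.
  by move=> i /negPf iN; rewrite ffunE iN expr0.
- by rewrite big_cat.
rewrite big_distrlr big_allpairs_dep /=.
by do 2!apply: eq_bigr => ? _; rewrite mono_add mulrACA.
Qed.

End Expansion.

(** * The action of the torus and of the root vectors *)

Section Torus.
Variable F : numFieldType.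
Variables (n N : nat) (e : 'I_N -> 'I_N -> pexp F ('I_n * 'I_n)).
Local Notation expo := {ffun 'I_n -> nat}.
Local Notation V := (pmx e).
Local Notation dV := (dpmx e).

(** May also contain exponents whose projector is zero; these contribute nothing to the sums
    below. *)
Definition weights : seq expo :=
  undup (flatten [seq [seq t.2 | t <- pexpand (e p.1 p.2)] | p : 'I_N * 'I_N]).

(* The projector onto the weight space of weight [m]. *)
Definition wproj (m : expo) : 'M[F]_N :=
  \matrix_(a, b) \sum_(t <- pexpand (e a b) | t.2 == m) t.1.

Lemma uniq_weights : uniq weights. Proof. exact: undup_uniq. Qed.

Lemma pmx_diagE z : V (diag_mx z) = \sum_(m <- weights) mono z m *: wproj m.
Proof.
apply/matrixP => a b; rewrite !mxE summxE pexpandE.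
under [RHS]eq_bigr do rewrite !mxE big_distrr /= big_mkcond /=.
rewrite exchange_big /= big_seq [RHS]big_seq; apply: eq_bigr => t te.
rewrite (bigD1_seq t.2) /= ?undup_uniq //.
  rewrite eqxx big1 ?addr0; first by rewrite mulrC.
  by move=> i /negPf iN; rewrite eq_sym iN.
rewrite mem_undup; apply/flatten_mapP; exists (a, b); first by rewrite mem_enum.
exact: map_f.
Qed.

Lemma wproj_out m : m \notin weights -> wproj m = 0.
Proof.
move=> mN; apply/matrixP => a b; rewrite !mxE big_seq_cond big1 // => t.
move=> /andP[te /eqP tm]; case/negP: mN; rewrite mem_undup; apply/flatten_mapP.
by exists (a, b); [rewrite mem_enum|rewrite -tm; apply: map_f].
Qed.

Lemma mono_freemx k l (A B : expo -> 'M[F]_(k, l)) (s : seq expo) : uniq s ->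
  (forall z, nonzero z ->
    \sum_(m <- s) mono z m *: A m = \sum_(m <- s) mono z m *: B m) ->
  {in s, forall m, A m = B m}.
Proof.
move=> us H m ms; apply/matrixP => i j; apply/eqP; rewrite -subr_eq0; apply/eqP.
apply: (mono_free (c := fun m => A m i j - B m i j) us _ ms) => z /H/matrixP/(_ i j).
rewrite !summxE => /eqP; rewrite -subr_eq0 -sumrB => /eqP E; rewrite -[RHS]E.
by apply: eq_bigr => k' _; rewrite !mxE; ring.
Qed.

Hypothesis pmx1 : V 1%:M = 1%:M.
Hypothesis pmxM : forall g h, V (g *m h) = V g *m V h.

Lemma diag_hadamard (z w : 'rV[F]_n) :
  diag_mx z *m diag_mx w = diag_mx (hadamard z w).
Proof.
by rewrite mulmx_diag; congr diag_mx; apply/rowP => i; rewrite !mxE.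
Qed.

(** Compare the coefficients of [mono w] in [V(z) V(w) = V(zw)], which is allowed by the
    independence of characters. *)
Lemma pmx_diag_wproj z m : V (diag_mx z) *m wproj m = mono z m *: wproj m.
Proof.
have [ms|/wproj_out->] := boolP (m \in weights); last by rewrite mulmx0 scaler0.
apply: (mono_freemx (A := fun m => V (diag_mx z) *m wproj m)
  (B := fun m => mono z m *: wproj m) uniq_weights _ ms) => w w0.
transitivity (V (diag_mx z *m diag_mx w)).
  rewrite pmxM [V (diag_mx w)]pmx_diagE mulmx_sumr.
  by apply: eq_bigr => k _; rewrite scalemxAr.
rewrite diag_hadamard pmx_diagE; apply: eq_bigr => k _.
by rewrite mono_hadamard scalerA mulrC.
Qed.

Lemma wproj_pmx_diag z m : wproj m *m V (diag_mx z) = mono z m *: wproj m.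
Proof.
have [ms|/wproj_out->] := boolP (m \in weights); last by rewrite mul0mx scaler0.
apply: (mono_freemx (A := fun m => wproj m *m V (diag_mx z))
  (B := fun m => mono z m *: wproj m) uniq_weights _ ms) => w w0.
transitivity (V (diag_mx w *m diag_mx z)).
  rewrite pmxM [V (diag_mx w)]pmx_diagE mulmx_suml.
  by apply: eq_bigr => k _; rewrite scalemxAl.
rewrite diag_hadamard pmx_diagE; apply: eq_bigr => k _.
by rewrite mono_hadamard scalerA.
Qed.

Lemma sum_wproj : \sum_(m <- weights) wproj m = 1%:M.
Proof.
rewrite -pmx1 -diag_const_mx pmx_diagE; apply: eq_bigr => m _.
by rewrite mono_const1 scale1r.
Qed.

Local Notation E i j := (dV (delta_mx i j)).

(** The diagonal matrix [1 + x E_ii] acts on the weight space by [(1 + x)^(m i)], whose derivative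
    at 0 is [m i]. *)
Lemma wproj_cartan i m : E i i *m wproj m = (m i)%:R *: wproj m.
Proof.
have H: pmxX e (tline (delta_mx i i)) *m map_mx polyC (wproj m) =
    (1 + 'X) ^+ m i *: map_mx polyC (wproj m).
  apply: polymx_eq => x; rewrite /evmx map_mxM -!/(evmx _ _) evmx_pmxX evmx_tline.
  have ->: 1%:M + x *: delta_mx i i = diag_mx (\row_j if j == i then 1 + x else 1).
    apply/matrixP => a b; rewrite !mxE; case: (eqVneq a b) => [->|ab].
      by case: eqVneq => _; rewrite /= ?mulr1 ?mulr0 ?addr0.
    rewrite mulr0n; case: (eqVneq a i) ab => [->|]; rewrite /= ?mulr0 ?addr0 //.
    by rewrite eq_sym => /negPf->; rewrite mulr0 addr0.
  rewrite evmxC pmx_diag_wproj /mono (bigD1 i) //= mxE eqxx big1 ?mulr1.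
    apply/matrixP => a b; by rewrite !mxE /horner_eval !hornerE.
  by move=> j /negPf ji; rewrite mxE ji expr1n.
have := congr1 (@dcoef _ _ _) H; rewrite dcoefM dcoefC mulmx0 addr0 evmxC -/(dV _) => ->.
apply/matrixP => a b; rewrite !mxE /= coefMC; congr (_ * _).
exact: coef1_exp1X.
Qed.

Let pmxMu : {in unitmx &, forall g h, V (g *m h) = V g *m V h}.
Proof. by move=> g h _ _; exact: pmxM. Qed.

(** Both [diag(z) E_ij = z_i E_ij] and [E_ij diag(z) = z_j E_ij] hold; the statement avoids division
    so that coordinates of [z] may vanish. *)
Lemma pmx_diag_root (z : 'rV[F]_n) i j :
  z 0 j *: (V (diag_mx z) *m E i j) = z 0 i *: (E i j *m V (diag_mx z)).
Proof.
rewrite scalemxAr scalemxAl -!dpmxZ //.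
apply: dpmx_conj => //.
apply/matrixP => a b; rewrite -scalemxAr -scalemxAl mul_diag_mx mul_mx_diag !mxE.
by case: eqVneq => [->|_]; case: eqVneq => [->|_]; rewrite /= ?mulr0 ?mul0r ?mulr1 ?mulr0 ?mul1r // mulrC.
Qed.

Lemma cartan_bracket i j : i != j ->
  E i j *m E j i = E j i *m E i j + (E i i - E j j).
Proof.
move=> ij; rewrite dpmx_bracket // !mul_delta_mx_cond; last by rewrite eq_sym (negPf ij).
by rewrite !eqxx !mulr1n -scaleN1r dpmxD // dpmxZ // scaleN1r.
Qed.

Definition root_trace (z : 'rV[F]_n) i j := \tr (V (diag_mx z) *m E i j *m E j i).

(** Write [T_ij] for the root trace and [Y_i] for the trace of [V(z) E_ii]. Cyclicity of the trace
    gives [z_j T_ij = z_i T_ji], the bracket gives [T_ji = T_ij - (Y_i - Y_j)]; eliminate [T_ji]. *)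
Lemma root_traceE (z : 'rV[F]_n) i j : i != j ->
  (z 0 i - z 0 j) * root_trace z i j =
    z 0 i * (\tr (V (diag_mx z) *m E i i) - \tr (V (diag_mx z) *m E j j)).
Proof.
move=> ij; have: z 0 j * root_trace z i j = z 0 i * root_trace z j i.
  rewrite /root_trace -!mxtraceZ scalemxAl pmx_diag_root -scalemxAl.
  by rewrite !mxtraceZ -mulmxA mxtrace_mulC.
rewrite {2}/root_trace -mulmxA.
have ->: E j i *m E i j = E i j *m E j i - (E i i - E j j) by rewrite (cartan_bracket ij) addrK.
rewrite 2!mulmxBr mulmxA 2!raddfB /= -/(root_trace z i j) mulrBl => ->.
move: (root_trace z i j) (\tr _) (\tr _) => t a b; ring.
Qed.

Lemma mxtrace_pmx_diag (z : 'rV[F]_n) :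
  \tr (V (diag_mx z)) = \sum_(m <- weights) \tr (wproj m) * mono z m.
Proof.
by rewrite pmx_diagE raddf_sum; apply: eq_bigr => m _; rewrite /= mxtraceZ mulrC.
Qed.

Lemma mxtrace_cartan (z : 'rV[F]_n) i : \tr (V (diag_mx z) *m E i i) =
  \sum_(m <- weights) (m i)%:R * (\tr (wproj m) * mono z m).
Proof.
rewrite -[_ *m E i i]mulmx1 -sum_wproj mulmx_sumr raddf_sum; apply: eq_bigr => m _ /=.
rewrite -mulmxA wproj_cartan -scalemxAr pmx_diag_wproj !mxtraceZ; ring.
Qed.

Lemma mxtrace_cartan2 (z : 'rV[F]_n) i : \tr (V (diag_mx z) *m E i i *m E i i) =
  \sum_(m <- weights) (m i)%:R ^+ 2 * (\tr (wproj m) * mono z m).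
Proof.
rewrite -[_ *m E i i *m _]mulmx1 -sum_wproj mulmx_sumr raddf_sum; apply: eq_bigr => m _ /=.
rewrite -!mulmxA wproj_cartan -!scalemxAr wproj_cartan -scalemxAr pmx_diag_wproj !mxtraceZ; ring.
Qed.

End Torus.

(** * The Laplacian of the Vandermonde determinant *)

(** The Leibniz rule at 0; [uniq s] ensures that [q != p] removes a single factor. *)
Lemma coef1_prod (R : comNzRingType) (I : eqType) (s : seq I) (f : I -> {poly R}) :
  uniq s -> (\prod_(p <- s) f p)`_1 =
    \sum_(p <- s) (f p)`_1 * \prod_(q <- s | q != p) (f q)`_0.
Proof.
have coef0_prod t : (\prod_(p <- t) f p)`_0 = \prod_(p <- t) (f p)`_0.
  by rewrite -horner_coef0 horner_prod; apply: eq_bigr => p _; rewrite horner_coef0.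
elim: s => [|a s IH] /=; first by rewrite !big_nil coefC.
case/andP=> aNs us; rewrite !big_cons eqxx coefM !big_ord_recl big_ord0 /= addr0.
rewrite /bump /= addrC subnn IH // coef0_prod; congr (_ * _ + _).
  rewrite big_seq [RHS]big_seq_cond; apply: eq_bigl => q.
  by case: eqVneq => [->|]; rewrite ?(negPf aNs) ?andbT.
rewrite big_distrr /= big_seq [RHS]big_seq; apply: eq_bigr => p ps.
rewrite big_cons; case: eqVneq => [ap|_]; first by rewrite ap ps in aNs.
by rewrite mulrCA.
Qed.

Section Alternants.
Variables (R : comNzRingType) (n : nat).

Definition alternant (z : 'rV[R]_n) (f : 'I_n -> nat) : R :=
  \sum_(s : 'S_n) (-1) ^+ s * \prod_i z 0 i ^+ f (s i).

(** For [n = r + 1] this is [r - i], the shift of [rho] by [r/2]. *)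
Definition staircase (i : 'I_n) : nat := (n.-1 - i)%N.

Definition pairs : seq ('I_n * 'I_n) :=
  [seq p : 'I_n * 'I_n <- index_enum ('I_n * 'I_n)%type | (p.1 < p.2)%N].

Lemma alternantE z f : alternant z f = \det (\matrix_(i, j) z 0 i ^+ f j).
Proof. by apply: eq_bigr => s _; congr (_ * _); apply: eq_bigr => i _; rewrite mxE. Qed.

Definition rev_perm : 'S_n := perm (inv_inj (@rev_ordK n)).

(** The Vandermonde matrix has increasing exponents; reversing their order costs the sign of
    [rev_perm]. *)
Lemma alternant_staircase z : alternant z staircase =
  (-1) ^+ rev_perm * \prod_(p <- pairs) (z 0 p.2 - z 0 p.1).
Proof.
have -> : \prod_(p <- pairs) (z 0 p.2 - z 0 p.1) = \det (Vandermonde n z).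
  by rewrite det_Vandermonde pair_big_dep /= big_filter.
rewrite alternantE -det_tr -det_perm -det_mulmx -row_permE; congr (\det _).
apply/matrixP => i j; rewrite !mxE permE /= /staircase; congr (_ ^+ _).
by have := ltn_ord i; lia.
Qed.

End Alternants.

Section LogDerivative.
Variables (F : fieldType) (n : nat) (z : 'rV[F]_n).

(* [z_i] times the derivative of the Vandermonde alternant in [z_i]. *)
Definition dalternant (i : 'I_n) : F :=
  \sum_(s : 'S_n) (-1) ^+ s * (staircase (s i))%:R * \prod_k z 0 k ^+ staircase (s k).

Let spair (i j : 'I_n) := if (i < j)%N then (i, j) else (j, i).

(** The quotient of the staircase alternant by [z_i - z_j], written as a product so that it makes
    sense when [z_i = z_j]. *)
Definition valternant (i j : 'I_n) : F :=
  (-1) ^+ rev_perm n * (if (i < j)%N then -1 else 1) *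
  \prod_(q <- pairs n | q != spair i j) (z 0 q.2 - z 0 q.1).

Lemma valternantE i j : i != j ->
  alternant z (@staircase n) = (z 0 i - z 0 j) * valternant i j.
Proof.
move=> ij; rewrite alternant_staircase (bigD1_seq (spair i j)) /=.
- rewrite /valternant /spair; move: ((-1) ^+ _) (\prod_(_ <- _ | _) _) => a b.
  by case: ifP => _ /=; ring.
- rewrite mem_filter mem_index_enum andbT /spair.
  by case: (ltngtP i j) => //= E; case/eqP: ij; apply/val_inj.
- by rewrite filter_uniq // index_enum_uniq.
Qed.

Lemma valternantC i j : i != j -> valternant j i = - valternant i j.
Proof.
move=> ij; rewrite /valternant /spair.
move: ((-1) ^+ _) => a; case: (ltngtP i j) => [_|_|E]; first by rewrite mulr1 mulrN1 mulNr opprK.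
  by rewrite mulr1 mulrN1 mulNr.
by case/eqP: ij; apply/val_inj.
Qed.

(** Replace [z_i] by [z_i (1 + t)] and compute the coefficient of [t] twice: from the sum over
    permutations and from the Vandermonde product. *)
Lemma dalternantE i :
  dalternant i = \sum_(j | j != i) z 0 i * valternant i j.
Proof.
pose u : 'rV[{poly F}]_n :=
  \row_k (z 0 k *: (1 + 'X *+ (k == i))).
have u0 k : (u 0 k)`_0 = z 0 k.
  by rewrite mxE coefZ coefD coefMn coefX coefC mul0rn addr0 mulr1.
have u1 k : (u 0 k)`_1 = z 0 k *+ (k == i).
  by rewrite mxE coefZ coefD coefMn coefX coefC add0r mulr_natr.
transitivity (alternant u (@staircase n))`_1.
  rewrite coef_sum; apply: eq_bigr => s _.
  have -> : (-1) ^+ s = ((-1) ^+ s)%:P :> {poly F} by rewrite rmorphXn rmorphN1.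
  rewrite coefCM -mulrA; congr (_ * _).
  rewrite coef1_prod ?index_enum_uniq // [RHS](bigD1 i) //= [X in _ = _ + X]big1.
    rewrite addr0 [X in _ * X](bigD1 i) //= mulrA; congr (_ * _).
      rewrite mxE eqxx mulr1n exprZn coefZ mulrC; congr (_ * _).
      by rewrite coef1_exp1X.
    apply: eq_bigr => k ki; rewrite mxE (negPf ki) mulr0n addr0 exprZn expr1n.
    by rewrite coefZ coefC mulr1.
  move=> k ki; rewrite mxE (negPf ki) mulr0n addr0 exprZn expr1n.
  by rewrite coefZ coefC mulr0 mul0r.
rewrite alternant_staircase.
have -> : (-1) ^+ rev_perm n = ((-1) ^+ rev_perm n)%:P :> {poly F}.
  by rewrite rmorphXn rmorphN1.
rewrite coefCM coef1_prod ?filter_uniq ?index_enum_uniq // big_filter.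
under eq_bigr => p _ do under eq_bigr => q _ do rewrite coefB !u0.
pose g p := (-1) ^+ rev_perm n * \prod_(q <- pairs n | q != p) (z 0 q.2 - z 0 q.1).
(* Only factors containing [z_i] have a derivative: those with [b = i] give the terms [j < i] of the
   claim, those with [a = i] the terms [j > i]. *)
transitivity (\sum_(a < n) \sum_(b < n | (a < b)%N) (z 0 b *+ (b == i) * g (a, b)
    - z 0 a *+ (a == i) * g (a, b))).
  rewrite mulr_sumr pair_big_dep /=; apply: eq_bigr => -[a b] _ /=.
  by rewrite coefB !u1 -mulrBl mulrCA.
under eq_bigr do rewrite sumrB.
rewrite sumrB [in RHS](bigID (fun j : 'I_n => (j < i)%N)) /=; congr (_ + _).
  rewrite [RHS]big_mkcond /=; apply: eq_bigr => a _.
  rewrite -(inj_eq val_inj) /=; case: ltngtP => // ai.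
  - rewrite (bigD1 i) //= eqxx mulr1n big1 ?addr0.
      by rewrite /valternant /spair ltnNge ltnW //= mulr1.
    by move=> b /andP[_ /negPf->]; rewrite mulr0n mul0r.
  - rewrite big1 // => b ab; case: eqP => [bi|]; last by rewrite mulr0n mul0r.
    by move: ab; rewrite bi ltnNge ltnW.
  - rewrite big1 // => b ab; case: eqP => [bi|]; last by rewrite mulr0n mul0r.
    by move: ab; rewrite bi ai ltnn.
rewrite (bigD1 i) //= [X in _ + X]big1 ?addr0; last first.
  by move=> a /negPf ai; rewrite big1 // => b _; rewrite ai mulr0n mul0r.
rewrite -sumrN; apply: eq_big => [j|j ij].
  by rewrite -(inj_eq val_inj) /=; case: ltngtP.
by rewrite eqxx mulr1n /valternant /spair ij /= mulrN1 mulNr mulrN.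
Qed.

(** With [D] the alternant and [v_ij] its quotient by [z_i - z_j], one has
    [D T_ij = z_i v_ij (Y_i - Y_j)]. The [Y_i] part sums by [dalternantE]; for the [Y_j] part use
    [z_i v_ij = D - z_j v_ji]. *)
Lemma alternant_laplace (T : 'I_n -> 'I_n -> F) (Y : 'I_n -> F) :
  (forall i j, i != j -> (z 0 i - z 0 j) * T i j = z 0 i * (Y i - Y j)) ->
  alternant z (@staircase n) * (\sum_i \sum_(j | j != i) T i j) =
    2 * (\sum_i dalternant i * Y i)
    - n.-1%:R * alternant z (@staircase n) * \sum_i Y i.
Proof.
set D := alternant _ _ => HT.
have E1 : \sum_i \sum_(j | j != i) z 0 i * valternant i j * Y i = \sum_i dalternant i * Y i.
  by apply: eq_bigr => i _; rewrite dalternantE big_distrl.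
have E2 : \sum_i \sum_(j | j != i) z 0 i * valternant i j * Y j =
    n.-1%:R * D * (\sum_i Y i) - \sum_i dalternant i * Y i.
  rewrite (exchange_big_dep xpredT) //= big_distrr -sumrB; apply: eq_bigr => j _ /=.
  rewrite dalternantE [in RHS]big_distrl /=.
  have -> : n.-1%:R * D * Y j = \sum_(i | j != i) D * Y j.
    rewrite sumr_const -mulrA -[D * _ in RHS]mul1r -mulrnAl; congr (_%:R * _).
    by rewrite (eq_card (B := predC1 j)) ?cardC1 ?card_ord // => i; rewrite !inE eq_sym.
  rewrite [X in _ - X](eq_bigl (fun i => j != i)); last by move=> i; rewrite eq_sym.
  rewrite -sumrB; apply: eq_bigr => i ji.
  by rewrite /D (valternantE (i := i) (j := j)) 1?eq_sym // (valternantC (i := i)) 1?eq_sym //; ring.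
transitivity (\sum_i \sum_(j | j != i) (z 0 i * valternant i j * Y i - z 0 i * valternant i j * Y j)).
  rewrite mulr_sumr; apply: eq_bigr => i _; rewrite mulr_sumr; apply: eq_bigr => j ji.
  rewrite /D (valternantE (i := i) (j := j)) 1?eq_sym // mulrAC HT 1?eq_sym //; ring.
under eq_bigr do rewrite sumrB.
by rewrite sumrB E1 E2; ring.
Qed.

End LogDerivative.

(** * Gauss decomposition *)

(** Take a subspace of maximal dimension inside [P]: a further vector of [P] would enlarge it. *)
Lemma vspace_of_pred (F : fieldType) (vT : vectType F) (P : vT -> Prop) :
  P 0 -> (forall a u v, P u -> P v -> P (a *: u + v)) ->
  exists W : {vspace vT}, forall v, v \in W <-> P v.
Proof.
move=> P0 PD; pose Q d := `[< exists W : {vspace vT}, (forall v, v \in W -> P v) /\ \dim W = d >].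
have Q0 : exists d, Q d.
  exists 0%N; apply/asboolP; exists 0%VS; split; last exact: dimv0.
  by move=> v; rewrite memv0 => /eqP->.
have Qle d : Q d -> (d <= dim vT)%N.
  by move=> /asboolP[W [_ <-]]; rewrite -dimvf dimvS // subvf.
case: (ex_maxnP Q0 Qle) => d /asboolP[W [WP Wd]] max; exists W => v; split; first exact: WP.
move=> Pv; apply/negPn/negP => vW.
have /max : Q (\dim (W + <[v]>)).
  apply/asboolP; exists (W + <[v]>)%VS; split=> // w /memv_addP[a aW [b /vlineP[k ->] ->]].
  by rewrite addrC; apply: PD => //; exact: WP.
rewrite -Wd => le.
have : (W == W + <[v]>)%VS by rewrite eqEdim addvSl.
by move/eqP => E; case/negP: vW; rewrite E memvE addvSr.
Qed.

Section Gauss.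
Variable F : fieldType.

Definition lower_uni n (L : 'M[F]_n) := is_trig_mx L /\ forall i, L i i = 1.

Lemma det_lower_uni n (L : 'M[F]_n) : lower_uni L -> \det L = 1.
Proof. by case=> trigL L1; rewrite det_trig // big1. Qed.

Lemma lower_uni_unit n (L : 'M[F]_n) : lower_uni L -> L \in unitmx.
Proof. by move=> /det_lower_uni; rewrite unitmxE => ->; rewrite unitr1. Qed.

(** Induction on the size: factor the upper left block and clear the last row and column. The new
    pivot is the Schur complement [s], nonzero because [\det A] is. *)
Lemma gauss_LDU n (A : 'M[F]_n) :
  (forall k (kn : (k <= n)%N),
     \det (mxsub (widen_ord kn) (widen_ord kn) A) != 0) ->
  exists L (z : 'rV[F]_n) U, [/\ lower_uni L, (forall i, z 0 i != 0),
    lower_uni U^T & A = L *m diag_mx z *m U].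
Proof.
elim: n A => [|n IH]; last rewrite -addn1 => A minors.
  move=> A _; exists 1%:M, 0, 1%:M; split; last by apply/matrixP; case.
  - by split; [exact: scalar_mx_is_trig|move=> i; rewrite !mxE eqxx].
  - by case.
  - by split; [rewrite trmx1; exact: scalar_mx_is_trig|move=> i; rewrite !mxE eqxx].
have [|L [z [U [uL z0 uU AE]]]] := IH (ulsubmx A).
  move=> k kn; have kn1 : (k <= n + 1)%N by rewrite addn1 ltnW.
  have := minors _ kn1; congr (\det _ != 0).
  by apply/matrixP => i j; rewrite !mxE; congr (A _ _); apply: val_inj.
have LU := lower_uni_unit uL.
have UU : U \in unitmx by rewrite -unitmx_tr lower_uni_unit.
have zU : diag_mx z \in unitmx.
  by rewrite unitmxE det_diag unitfE; apply/prodf_neq0 => i _.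
have AU : ulsubmx A \in unitmx by rewrite AE !unitmx_mul LU zU.
have invE : invmx (ulsubmx A) = invmx U *m invmx (diag_mx z) *m invmx L.
  rewrite -[RHS]mul1mx -(mulVmx AU) -mulmxA {3}AE -!mulmxA (mulKVmx UU).
  by rewrite (mulKVmx zU) mulmxV // mulmx1.
pose s := drsubmx A - dlsubmx A *m invmx (ulsubmx A) *m ursubmx A.
pose L' := block_mx L 0 (dlsubmx A *m invmx U *m invmx (diag_mx z)) 1%:M.
pose U' := block_mx U (invmx (diag_mx z) *m invmx L *m ursubmx A) 0 (1%:M : 'M[F]_1).
have E : A = L' *m diag_mx (row_mx z s) *m U'.
  rewrite diag_mx_row /L' /U' !mulmx_block !mulmx0 !mul0mx !addr0 !add0r mul1mx.
  rewrite !mulmx1 -[LHS]submxK mulmxKV // -AE; congr block_mx.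
  - by rewrite addr0 !mulmxA mulmxK // mulmxV // mul1mx.
  - by rewrite mulmxKV.
  - have -> : diag_mx s = s by apply/matrixP => i j; rewrite !ord1 !mxE eqxx mulr1n.
    by rewrite /s invE !mulmxA addrC subrK.
have uL' : lower_uni L'.
  split.
    by rewrite is_trig_block_mx // eqxx (proj1 uL) scalar_mx_is_trig.
  move=> i; case: (split_ordP i) => j ->; rewrite ?block_mxEul ?block_mxEdr ?mxE ?eqxx //.
  exact: (proj2 uL).
have uU' : lower_uni U'^T.
  rewrite /U' tr_block_mx trmx0 trmx1; split.
    by rewrite is_trig_block_mx // eqxx (proj1 uU) scalar_mx_is_trig.
  move=> i; case: (split_ordP i) => j ->; rewrite ?block_mxEul ?block_mxEdr ?mxE ?eqxx //.
  by have := proj2 uU j; rewrite mxE.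
exists L', (row_mx z s), U'; split=> // i.
have : \det (diag_mx (row_mx z s)) != 0.
  have := minors _ (leqnn _); rewrite (_ : mxsub _ _ A = A); last first.
    by apply/matrixP => a b; rewrite mxE; congr (A _ _); apply: val_inj.
  rewrite E !det_mulmx (det_lower_uni uL') mul1r -[\det U']det_tr.
  by rewrite (det_lower_uni uU') mulr1.
by rewrite det_diag => /prodf_neq0; apply.
Qed.

End Gauss.

(** * The Casimir element *)

Lemma card_ord_lt n (k : nat) : (k <= n)%N -> #|[pred i : 'I_n | (i < k)%N]| = k.
Proof.
move=> kn; rewrite -sum1_card -(big_ord_widen n (fun=> 1%N) kn).
by rewrite sum_nat_const card_ord muln1.
Qed.

Lemma card_ord_gt n (i : 'I_n) : #|[pred j : 'I_n | (i < j)%N]| = (n.-1 - i)%N.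
Proof.
have := cardC [pred j : 'I_n | (j < i.+1)%N]; rewrite card_ord_lt // card_ord.
have -> : #|[predC [pred j : 'I_n | (j < i.+1)%N]]| = #|[pred j : 'I_n | (i < j)%N]|.
  by apply: eq_card => j; rewrite !inE -ltnNge.
by have := ltn_ord i; lia.
Qed.

Section HighestWeight.
Variable F : numFieldType.
Variables (n N : nat) (e : 'I_N -> 'I_N -> pexp F ('I_n * 'I_n)).
Local Notation expo := {ffun 'I_n -> nat}.
Local Notation V := (pmx e).
Local Notation dV := (dpmx e).
Local Notation E i j := (dV (delta_mx i j)).

Hypothesis pmx1 : V 1%:M = 1%:M.
Hypothesis pmxM : forall g h, V (g *m h) = V g *m V h.
Hypothesis irrV : forall W : {vspace 'cV[F]_N},
  {in unitmx, forall (g : 'M[F]_n) (w : 'cV[F]_N), w \in W -> V g *m w \in W} ->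
  W = 0%VS \/ W = fullv.

Let pmxMu : {in unitmx &, forall g h, V (g *m h) = V g *m V h}.
Proof. by move=> g h _ _; exact: pmxM. Qed.

Lemma irr_pred (P : 'cV[F]_N -> Prop) v : v != 0 -> P v ->
  (forall a u w, P u -> P w -> P (a *: u + w)) ->
  {in unitmx, forall g w, P w -> P (V g *m w)} -> forall w, P w.
Proof.
move=> v0 Pv PD PV.
have P0 : P 0 by rewrite -(subrr v) -scaleN1r addrC; exact: PD.
have [W WP] := vspace_of_pred P0 PD.
have [g gu w|W0|Wfull w] := irrV (W := W).
- by move/WP => Pw; apply/WP; exact: PV.
- by move/WP: Pv; rewrite W0 memv0 (negPf v0).
- by apply/WP; rewrite Wfull memvf.
Qed.

(** The quadratic Casimir plus a central linear term, chosen so that its eigenvalue involves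
    [staircase] in place of [rho]. *)
Definition casimir : 'M[F]_N :=
  \sum_i \sum_j E i j *m E j i + n.-1%:R *: \sum_i E i i.

(** Expand the conjugates of [E_ij] and [E_ji] in matrix units; the sums over [i] and [j] collapse
    to entries of [g g^-1 = 1]. *)
Lemma casimir_comm g : g \in unitmx -> V g *m casimir = casimir *m V g.
Proof.
move=> gu; pose h := invmx g.
have conj X : V g *m dV X = dV (g *m X *m h) *m V g.
  by apply: dpmx_conj => //; rewrite mulmxKV.
have conjE i j : V g *m E i j = (\sum_p (g p.1 i * h j p.2) *: E p.1 p.2) *m V g.
  rewrite conj; congr (_ *m _).
  have -> : g *m delta_mx i j *m h = \sum_p (g p.1 i * h j p.2) *: delta_mx p.1 p.2.
    rewrite [LHS]matrix_sum_delta pair_big /=; apply: eq_bigr => p _; congr (_ *: _).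
    rewrite mxE (bigD1 j) //= mxE (bigD1 i) //= !mxE !eqxx mulr1 !big1 ?addr0 //.
      by move=> k /negPf kj; rewrite !mxE big1 ?mul0r // => l _; rewrite !mxE kj andbF mulr0.
    by move=> k /negPf ki; rewrite !mxE ki mulr0.
  by rewrite dpmx_sum //; apply: eq_bigr => p _; rewrite dpmxZ.
rewrite /casimir mulmxDr mulmxDl -scalemxAr -scalemxAl; congr (_ + _ *: _); last first.
  rewrite -!dpmx_sum //; apply: dpmx_conj => //.
  have -> : \sum_i delta_mx i i = 1%:M :> 'M[F]_n.
    apply/matrixP => i j; rewrite summxE (bigD1 i) //= !mxE eqxx /= big1 ?addr0.
      by rewrite eq_sym.
    by move=> k ki; rewrite !mxE eq_sym (negPf ki).
  by rewrite mulmx1 mul1mx.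
rewrite !pair_big /= mulmx_sumr.
transitivity ((\sum_p \sum_q \sum_q' (g q.1 p.1 * h p.2 q.2 * (g q'.1 p.2 * h p.1 q'.2))
    *: (E q.1 q.2 *m E q'.1 q'.2)) *m V g).
  rewrite mulmx_suml; apply: eq_bigr => p _.
  rewrite mulmxA conjE -[_ *m V g *m _]mulmxA conjE mulmxA; congr (_ *m _).
  rewrite mulmx_suml; apply: eq_bigr => q _; rewrite mulmx_sumr; apply: eq_bigr => q' _.
  by rewrite -scalemxAl -scalemxAr scalerA.
congr (_ *m _).
rewrite exchange_big /=; apply: eq_bigr => -[a b] _ /=.
(* The coefficient of [E_ab E_cd] is the product of the entries [(a, d)] and [(c, b)] of the
   identity, so only [(c, d) = (b, a)] survives. *)
rewrite exchange_big /= (bigD1 (b, a)) //= [X in _ + X]big1 ?addr0.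
  rewrite -scaler_suml (_ : \sum_i _ = (g *m h) a a * (g *m h) b b).
    by rewrite mulmxV // !mxE !eqxx mulr1 scale1r.
  rewrite !mxE big_distrlr pair_big; apply: eq_bigr => -[i j] _ /=; ring.
move=> [c d] /eqP ne /=.
rewrite -scaler_suml (_ : \sum_i _ = (g *m h) a d * (g *m h) c b).
  rewrite mulmxV // !mxE; case: (eqVneq a d) => [ad|_]; last by rewrite mul0r scale0r.
  by case: (eqVneq c b) => [cb|_]; [case: ne; rewrite ad cb|rewrite mulr0 scale0r].
rewrite !mxE big_distrlr pair_big; apply: eq_bigr => -[i j] _ /=; ring.
Qed.

Variables (l : expo) (v : 'cV[F]_N).
Hypothesis v_neq0 : v != 0.
Hypothesis v_weight : forall z, nonzero z -> V (diag_mx z) *m v = mono z l *: v.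
Hypothesis v_upper : forall u, lower_uni u^T -> V u *m v = v.

(** Differentiate the invariance of [v] under the upper unitriangular matrices [1 + x E_ij]. *)
Lemma raising_v (i j : 'I_n) : (i < j)%N -> E i j *m v = 0.
Proof.
move=> ij; have H: pmxX e (tline (delta_mx i j)) *m map_mx polyC v = map_mx polyC v.
  apply: polymx_eq => x; rewrite /evmx map_mxM -!/(evmx _ _) evmx_pmxX evmx_tline.
  rewrite !evmxC v_upper //; split.
    apply/is_trig_mxP => a b ab; rewrite !mxE.
    have -> : (b == a) = false by apply/eqP => ba; rewrite ba ltnn in ab.
    case: (eqVneq b i) => [bi|_]; case: (eqVneq a j) => [aj|_] /=; rewrite ?mulr0 ?addr0 //.
    by move: ab; rewrite aj bi ltnNge ltnW.
  move=> a; rewrite !mxE eqxx; case: eqP => [->|_] /=; last by rewrite mulr0 addr0.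
  by case: eqP => [ij'|_] /=; [rewrite ij' ltnn in ij|rewrite mulr0 addr0].
by have := congr1 (@dcoef _ _ _) H; rewrite dcoefM dcoefC mulmx0 addr0 evmxC.
Qed.

(** Applying the projector of [k] to [V(z) v] multiplies its value on [v] both by [z^k] and by
    [z^l]; independence of characters kills it when [k] differs from [l]. The projectors sum to 1,
    which settles [m = l]. *)
Lemma wproj_v m : wproj e m *m v = if m == l then v else 0.
Proof.
have out k : k != l -> wproj e k *m v = 0.
  move=> kl; pose A (k' : expo) := if k' == k then wproj e k *m v else - (wproj e k *m v).
  have ukl : uniq [:: k; l] by rewrite /= inE kl.
  have := @mono_freemx F n _ _ A (fun=> 0) _ ukl.
  move=> /(_ _ k (mem_head _ _)); rewrite /A eqxx; apply.
  move=> z z0; rewrite !big_cons !big_nil eqxx eq_sym (negPf kl) !scaler0 !addr0.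
  rewrite scalemxAl -wproj_pmx_diag // -mulmxA v_weight //.
  by rewrite -scalemxAr scalerN subrr.
case: eqP => [->|/eqP]; last exact: out.
have := sum_wproj pmx1; move/(congr1 (fun A => A *m v)); rewrite mul1mx mulmx_suml.
have [lw|lN] := boolP (l \in weights e).
  by rewrite (bigD1_seq l) //= ?uniq_weights // big1 ?addr0.
rewrite big_seq big1 => [v0|m' mw]; first by case/eqP: v_neq0.
by apply: out; apply: contraNneq lN => <-.
Qed.

Lemma cartan_v i : E i i *m v = (l i)%:R *: v.
Proof.
have <- : wproj e l *m v = v by rewrite wproj_v eqxx.
by rewrite mulmxA wproj_cartan // scalemxAl.
Qed.

Local Notation delta := (@staircase n).

(** For [i > j] the right factor [E_ji] kills [v]; for [i < j] the bracket leaves [l_i - l_j].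
    Counting pairs, [l_i] gets the coefficient [(n - 1 - i) - i], and the linear term of [casimir]
    raises it to twice [delta i]. *)
Lemma casimir_v : casimir *m v =
  (\sum_i (l i + delta i)%:R ^+ 2 - \sum_i (delta i)%:R ^+ 2) *: v.
Proof.
have Eij i j : E i j *m E j i *m v = (if i == j then (l i)%:R ^+ 2
    else if (i < j)%N then (l i)%:R - (l j)%:R else 0) *: v.
  case: (eqVneq i j) => [->|ij].
    by rewrite -mulmxA !cartan_v -scalemxAr cartan_v scalerA expr2.
  case: (ltngtP i j) => [lt|gt|/val_inj ?]; last by subst; rewrite eqxx in ij.
    rewrite cartan_bracket // mulmxDl -mulmxA raising_v // mulmx0 add0r.
    by rewrite mulmxBl !cartan_v scalerBl.
  by rewrite -mulmxA raising_v // mulmx0 scale0r.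
rewrite /casimir mulmxDl mulmx_suml -scalemxAl mulmx_suml.
under eq_bigr => i _ do rewrite mulmx_suml.
under eq_bigr => i _ do under eq_bigr => j _ do rewrite Eij.
under eq_bigr do rewrite -scaler_suml.
under [X in _ + _ *: X]eq_bigr do rewrite cartan_v.
rewrite -!scaler_suml scalerA -scalerDl; congr (_ *: v).
pose L (i : 'I_n) : F := (l i)%:R.
transitivity (\sum_i (L i ^+ 2 + \sum_(j < n) ((if (i < j)%N then L i else 0)
    - (if (i < j)%N then L j else 0))) + n.-1%:R * \sum_i L i).
  congr (_ + _); apply: eq_bigr => i _; rewrite (bigD1 i) //= eqxx; congr (_ + _).
  rewrite [RHS](bigD1 i) //= ltnn subrr add0r; apply: eq_bigr => j ji.
  by rewrite eq_sym (negPf ji); case: ifP; rewrite ?subrr.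
have E1 : \sum_(i < n) \sum_(j < n) (if (i < j)%N then L i else 0) =
    \sum_(i < n) (delta i)%:R * L i.
  apply: eq_bigr => i _; rewrite -big_mkcond sumr_const -[L i *+ _]mulr_natl.
  by rewrite card_ord_gt.
have E2 : \sum_(i < n) \sum_(j < n) (if (i < j)%N then L j else 0) =
    \sum_(j < n) j%:R * L j.
  rewrite exchange_big; apply: eq_bigr => j _; rewrite -big_mkcond sumr_const.
  by rewrite -[L j *+ _]mulr_natl (card_ord_lt (ltnW (ltn_ord j))).
under eq_bigr do rewrite sumrB.
rewrite big_split sumrB /= E1 E2 -sumrB mulr_sumr -!big_split -sumrB /=.
apply: eq_bigr => i _; rewrite /L /staircase natrD natrB; last by have := ltn_ord i; lia.
ring.
Qed.

(** Schur's lemma: the eigenspace containing [v] is invariant and nonzero, hence everything. *)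
Lemma casimirE : casimir =
  (\sum_i (l i + delta i)%:R ^+ 2 - \sum_i (delta i)%:R ^+ 2)%:M.
Proof.
set c := _ - _.
have H (w : 'cV[F]_N) : casimir *m w = c *: w.
  pose P (w : 'cV[F]_N) := casimir *m w = c *: w.
  have PD a u u' : P u -> P u' -> P (a *: u + u').
    by rewrite /P => Hu Hu'; rewrite mulmxDr -scalemxAr Hu Hu' scalerDr !scalerA mulrC.
  have PV : {in unitmx, forall (g : 'M[F]_n) u, P u -> P (V g *m u)}.
    by move=> g gu u Hu; rewrite /P mulmxA -casimir_comm // -mulmxA Hu scalemxAr.
  exact: (irr_pred v_neq0 casimir_v PD PV).
move: H; move: casimir c => C c H; apply/matrixP => i j.
have /matrixP/(_ i 0) := H (delta_mx j 0); rewrite -colE !mxE => ->.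
by rewrite andbT mulr_natr.
Qed.

End HighestWeight.

(** * Dominance of the highest weight *)

Lemma mono_expX (F : numFieldType) n (y : F) (d : 'I_n -> nat) (m : {ffun 'I_n -> nat}) :
  mono (\row_i y ^+ d i) m = y ^+ (\sum_i d i * m i).
Proof. by rewrite expr_sum; apply: eq_bigr => i _; rewrite mxE exprM. Qed.

Lemma scalemx_inj (R : idomainType) m n (a : R) (A B : 'M[R]_(m, n)) :
  a != 0 -> a *: A = a *: B -> A = B.
Proof.
move=> a0 /matrixP H; apply/matrixP => i j; apply: (mulfI a0).
by have := H i j; rewrite !mxE.
Qed.

Section Dominance.
Variable F : numFieldType.
Variables (n N : nat) (e : 'I_N -> 'I_N -> pexp F ('I_n * 'I_n)).
Local Notation expo := {ffun 'I_n -> nat}.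
Local Notation V := (pmx e).

Hypothesis pmx1 : V 1%:M = 1%:M.
Hypothesis pmxM : forall g h, V (g *m h) = V g *m V h.
Hypothesis irrV : forall W : {vspace 'cV[F]_N},
  {in unitmx, forall (g : 'M[F]_n) (w : 'cV[F]_N), w \in W -> V g *m w \in W} ->
  W = 0%VS \/ W = fullv.
Variables (l : expo) (v : 'cV[F]_N).
Hypothesis v_neq0 : v != 0.
Hypothesis v_weight : forall z, nonzero z -> V (diag_mx z) *m v = mono z l *: v.
Hypothesis v_upper : forall u, lower_uni u^T -> V u *m v = v.

(* The big cell [L D U] is dense and [D U] fixes the line of [v]. *)
Lemma lower_orbit_total k (f : 'M[F]_(k, N)) :
  (forall L, lower_uni L -> f *m V L *m v = 0) -> f = 0.
Proof.
move=> fL; have fG g : f *m V g *m v = 0.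
  pose minor k (kn : (k <= n)%N) := \det (shiftp (mxsub (widen_ord kn) (widen_ord kn) g)).
  (* All leading minors of [g + x 1], of sizes 0 to [n]; where [q] is nonzero the Gauss
     decomposition exists. *)
  pose q := \prod_(i < n.+1) minor _ (leq_ord i).
  have H : map_mx polyC f *m pmxX e (shiftp g) *m map_mx polyC v = 0.
    apply: (@polymx_generic _ _ _ _ _ q).
      by apply/prodf_neq0 => i _; exact: det_shiftp_neq0.
    move=> x; rewrite horner_prod => /prodf_neq0 qx.
    rewrite /evmx map_mx0 !map_mxM -!/(evmx _ _) evmx_pmxX evmx_shiftp !evmxC.
    have [k' kn|L [z [U [uL z0 uU ->]]]] := @gauss_LDU _ _ (g + x%:M).
      have := qx (Ordinal (kn : (k' < n.+1)%N)) isT; rewrite -det_evmx evmx_shiftp.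
      congr (\det _ != 0); apply/matrixP => i j; rewrite !mxE; congr (g _ _ + _ *+ _); exact: val_inj.
    rewrite !pmxM !mulmxA -[_ *m V U *m v]mulmxA v_upper // -[_ *m V (diag_mx z) *m v]mulmxA v_weight //.
    by rewrite -scalemxAr fL // scaler0.
  have := congr1 (evmx 0) H; rewrite /evmx map_mx0 !map_mxM -!/(evmx _ _).
  by rewrite evmx_pmxX evmx_shiftp !evmxC raddf0 addr0.
(* This condition is linear and invariant and holds for [v]; irreducibility extends it to all
   vectors, and [g = 1] gives [f = 0]. *)
pose P (w : 'cV[F]_N) := forall g, f *m V g *m w = 0.
have PD a u u' : P u -> P u' -> P (a *: u + u').
  by move=> Pu Pu' g; rewrite mulmxDr -scalemxAr Pu Pu' scaler0 addr0.
have PV : {in unitmx, forall (g : 'M[F]_n) u, P u -> P (V g *m u)}.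
  by move=> g _ u Pu h; rewrite mulmxA -[f *m _ *m _]mulmxA -pmxM.
have Pall := irr_pred irrV v_neq0 fG PD PV.
apply/matrixP => i j; have /matrixP/(_ i 0) := Pall (delta_mx j 0) 1%:M.
by rewrite pmx1 mulmx1 -colE !mxE.
Qed.

(* [t L t^-1] for [t = diag(y^(- d i))], which is polynomial in [y]. *)
Definition contraction (d : 'I_n -> nat) (L : 'M[F]_n) : 'M[{poly F}]_n :=
  \matrix_(i, j) ('X ^+ (d j - d i) * (L i j)%:P).

(** Where [L i j] may be nonzero, [j <= i] and thus [d i <= d j], so the natural subtraction
    [d j - d i] is not truncated. *)
Lemma contractionE (d : 'I_n -> nat) L x : {homo d : i j / (i <= j)%N >-> (j <= i)%N} ->
  is_trig_mx L ->
  L *m diag_mx (\row_i x ^+ d i) =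
  diag_mx (\row_i x ^+ d i) *m evmx x (contraction d L).
Proof.
move=> hd /is_trig_mxP L0; rewrite mul_mx_diag mul_diag_mx.
apply/matrixP => i j; rewrite !mxE /horner_eval !hornerE /=.
case: (leqP j i) => [ji|/L0->]; last by rewrite !(mulr0, mul0r).
by rewrite -exprD subnKC ?hd // mulrC.
Qed.

(** Insert [t = diag(x^(d i))] in front of [v], move it through [L], and let the projector absorb
    it: [v] yields the power for [l], the projector that for [m]. *)
Lemma wproj_contraction (d : 'I_n -> nat) L m : {homo d : i j / (i <= j)%N >-> (j <= i)%N} ->
  lower_uni L ->
  'X ^+ (\sum_i d i * l i) *: map_mx polyC (wproj e m *m V L *m v) =
  'X ^+ (\sum_i d i * m i) *:
     (map_mx polyC (wproj e m) *m pmxX e (contraction d L) *m map_mx polyC v).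
Proof.
move=> hd [trigL _]; apply: (@polymx_generic _ _ _ _ _ 'X); first by rewrite polyX_eq0.
move=> x; rewrite hornerX => x0.
have evZ k (Q : 'M[{poly F}]_(N, 1)) : evmx x ('X ^+ k *: Q) = x ^+ k *: evmx x Q.
  by apply/matrixP => i j; rewrite !mxE /horner_eval !hornerE.
rewrite !evZ evmxC /evmx !map_mxM -!/(evmx _ _) evmx_pmxX !evmxC.
rewrite -!mono_expX; set t := \row_i _.
have t0 : nonzero t by move=> i; rewrite mxE expf_neq0.
rewrite scalemxAr -v_weight // mulmxA -[_ *m V L *m _]mulmxA -pmxM.
by rewrite contractionE // pmxM mulmxA wproj_pmx_diag // -!scalemxAl.
Qed.

(** Otherwise the right side of [wproj_contraction] has no term in the degree of the left side, so
    the projector vanishes on the lower orbit of [v]. *)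
Lemma weight_dominated (d : 'I_n -> nat) m : {homo d : i j / (i <= j)%N >-> (j <= i)%N} ->
  wproj e m != 0 -> (\sum_i d i * m i <= \sum_i d i * l i)%N.
Proof.
move=> hd A0; rewrite leqNgt; apply/negP => lt; case/eqP: A0.
apply: lower_orbit_total => L uL; have := wproj_contraction m hd uL.
move: (wproj e m *m V L *m v) (map_mx polyC (wproj e m) *m _ *m _) => A B H; apply/matrixP => i j.
move/matrixP/(_ i j)/(congr1 (coefp (\sum_i d i * l i))): H.
by rewrite !mxE /= !coefXnM lt ltnn subnn coefC eqxx.
Qed.

Lemma wproj_highest : wproj e l *m v = v.
Proof. by rewrite (wproj_v pmx1 pmxM v_neq0 v_weight) eqxx. Qed.

(** For strictly decreasing [d] the contraction of [L] at 0 is the identity, so the projector sends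
    the whole lower orbit to [v]. With a form [psi] such that [psi v = 1], it equals [v psi] times
    itself, and its trace is [psi v]. *)
Lemma highest_multiplicity : \tr (wproj e l) = 1.
Proof.
have orbit L : lower_uni L -> wproj e l *m V L *m v = v.
  move=> uL; pose d (i : 'I_n) := (n - i)%N.
  have hd : {homo d : i j / (i <= j)%N >-> (j <= i)%N}.
    by move=> i j; rewrite /d; lia.
  have := wproj_contraction l hd uL.
  move/(scalemx_inj (expf_neq0 _ (negbT (polyX_eq0 F)))).
  move/(congr1 (evmx 0)); rewrite /evmx !map_mxM -!/(evmx _ _) evmx_pmxX !evmxC.
  rewrite (_ : evmx 0 _ = 1%:M) ?pmx1 ?mulmx1 ?wproj_highest //.
  apply/matrixP => i j; rewrite !mxE /horner_eval !hornerE.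
  have [->|ij] := eqVneq i j; first by rewrite subnn expr0 mul1r (proj2 uL).
  rewrite expr0n; case: (ltngtP i j) => [lt|lt|/val_inj E]; last by rewrite E eqxx in ij.
    by rewrite (is_trig_mxP (proj1 uL)) // mulr0.
  by rewrite (_ : (_ == 0)%N = false) ?mul0r // /d; have := ltn_ord i; lia.
have [i vi] : exists i, v i 0 != 0.
  apply/existsP; apply/contraT; rewrite negb_exists => /forallP H.
  by case/eqP: v_neq0; apply/matrixP => a b; rewrite ord1 mxE; apply/eqP/negPn/H.
pose psi : 'rV[F]_N := (v i 0)^-1 *: delta_mx 0 i.
have psiv : psi *m v = 1%:M.
  rewrite /psi -scalemxAl -rowE; apply/matrixP => a b; rewrite !ord1 !mxE.
  by rewrite mulVf.
have /eqP : wproj e l - v *m psi *m wproj e l = 0.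
  apply: lower_orbit_total => L uL; rewrite !mulmxBl orbit // -!mulmxA.
  by rewrite [wproj e l *m (_ *m _)]mulmxA orbit // psiv mulmx1 subrr.
rewrite subr_eq0 => /eqP ->.
by rewrite -mulmxA mxtrace_mulC -mulmxA wproj_highest psiv mxtrace1.
Qed.

End Dominance.

(** * The longest weight *)

Section Combinatorics.
Local Open Scope nat_scope.
Variable n : nat.
Local Notation expo := {ffun 'I_n -> nat}.

Definition nonincreasing (d : 'I_n -> nat) := {homo d : i j / i <= j >-> j <= i}.

Lemma sorting_perm (m : 'I_n -> nat) : exists p : 'S_n, nonincreasing (m \o p).
Proof.
have sP : perm_eq [tuple of sort geq [tuple m i | i < n]] [tuple m i | i < n].
  by apply/permPl/perm_sort.
have [p pE] := tuple_permP sP.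
have srt : sorted geq (sort geq [tuple m i | i < n]).
  by apply: sort_sorted => a b; exact: leq_total.
exists p => i j ij; have mE k : (m \o p) k = nth 0 (sort geq [tuple m i | i < n]) k.
  by rewrite pE (nth_map k) ?size_enum_ord ?ltn_ord // nth_ord_enum !tnth_mktuple.
rewrite !mE; apply: (sorted_leq_nth _ _ _ srt) => //.
- by move=> a b c /= ab bc; exact: leq_trans bc ab.
- by move=> a /=.
- by rewrite inE size_sort size_tuple.
- by rewrite inE size_sort size_tuple.
Qed.

Lemma nonincreasing_staircase : nonincreasing (@staircase n).
Proof. by move=> i j; rewrite /staircase; lia. Qed.

Lemma sum_mul_le (a b : 'I_n -> nat) :
  \sum_i 2 * (a i * b i) <= \sum_i (a i ^ 2 + b i ^ 2) ?= iff [forall i, a i == b i].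
Proof. by apply: leqif_sum => i _; exact: nat_Cauchy. Qed.

(* Equality in the norm estimate that makes [l + rho] the longest weight. *)
Lemma dominated_norm_eq (l m : 'I_n -> nat) : nonincreasing l ->
  (forall (p : 'S_n) d, nonincreasing d ->
     \sum_i d i * m (p i) <= \sum_i d i * l i) ->
  \sum_i (m i + staircase i) ^ 2 = \sum_i (l i + staircase i) ^ 2 ->
  m =1 l.
Proof.
move=> hl dom; pose B := \sum_i l i.
have lB i : l i <= B by rewrite /B (bigD1 i) //= leq_addr.
have sqE (x : 'I_n -> nat) : \sum_i (x i + staircase i) ^ 2 =
    \sum_i x i ^ 2 + 2 * (\sum_i staircase i * x i) + \sum_i @staircase n i ^ 2.
  rewrite big_distrr -!big_split /=; apply: eq_bigr => i _.
  by rewrite sqrnD [x i * _]mulnC addnAC.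
rewrite !sqE => E.
have permE (p : 'S_n) (f : nat -> nat) : \sum_i f (m (p i)) = \sum_i f (m i).
  by rewrite [RHS](reindex_inj (@perm_inj _ p)).
have [p hp] := sorting_perm m.
(* Writing [m'] for the sorted [m], these give [<m', m'> <= <m', l> <= <l, l>]. Together with
   [<delta, m> <= <delta, l>], the equality of shifted norms forces [|m| = |l|] and
   [<delta, m> = <delta, l>]. *)
have le1 := dom p _ hp; have le2 := dom p _ hl.
have le3 := dom 1%g _ nonincreasing_staircase.
move: le3; under eq_bigr do rewrite perm1; move=> le3.
have sqm : \sum_i m (p i) * m (p i) = \sum_i m i ^ 2.
  by rewrite (permE p (fun x => x * x)); apply: eq_bigr => i _; rewrite mulnn.
have sql : \sum_i l i * l i = \sum_i l i ^ 2 by apply: eq_bigr => i _; rewrite mulnn.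
have C : \sum_i m (p i) * l i = \sum_i l i * m (p i).
  by apply: eq_bigr => i _; rewrite mulnC.
rewrite /= sqm C in le1; rewrite sql in le2.
have Em : \sum_i m i ^ 2 = \sum_i l i ^ 2 by lia.
have Ed : \sum_i staircase i * m i = \sum_i staircase i * l i by lia.
(* Equality case of [2ab <= a^2 + b^2]; hence [m] is a permutation of [l] and has the same sum. *)
have mpl : [forall i, m (p i) == l i].
  rewrite -(sum_mul_le (m \o p) l).2 eqn_leq (sum_mul_le _ _).1 /=.
  rewrite -big_distrr big_split /= (permE p (fun x => x ^ 2)) C Em addnn -mul2n.
  by rewrite leq_mul2l -Em le1.
have Es : \sum_i m i = \sum_i l i.
  by rewrite -(permE p id); apply: eq_bigr => i _; exact/eqP/(forallP mpl).
(* The multiple of the staircase makes this vector nonincreasing despite [- l]. As [m] and [l] pair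
   equally with the staircase and with constants, domination becomes [<l, l> <= <l, m>], and equal
   norms give [m = l]. *)
have := dom 1%g (fun i => B * staircase i + (B - l i)).
under eq_bigr do rewrite perm1 mulnDl -mulnA.
under [X in _ <= X]eq_bigr do rewrite mulnDl -mulnA.
rewrite !big_split -!big_distrr /= Ed leq_add2l => le4.
have BE (x : 'I_n -> nat) : \sum_i (B - l i) * x i + \sum_i l i * x i = B * \sum_i x i.
  rewrite -big_split big_distrr; apply: eq_bigr => i _ /=.
  by rewrite -mulnDl subnK.
have := BE m; have := BE l; rewrite Es sql => B1 B2.
have {le4} le4 : \sum_i l i ^ 2 <= \sum_i l i * m i.
  suff : \sum_i (B - l i) * m i <= \sum_i (B - l i) * l i by lia.
  apply: le4 => i j ij; have := hl _ _ ij; have := lB i; have := lB j.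
  have := ltn_ord j; rewrite /staircase.
  have [->|] := eqVneq i j; first by lia.
  rewrite -(inj_eq val_inj) /= => ne jn lj li lij.
  have -> : n.-1 - i = (n.-1 - j) + (j - i) by lia.
  have : 0 < j - i by lia.
  by case: (j - i) => // k _; rewrite mulnDr mulnS; lia.
have : [forall i, l i == m i].
  rewrite -(sum_mul_le l m).2 eqn_leq (sum_mul_le _ _).1 /=.
  by rewrite -big_distrr big_split /= Em addnn -mul2n leq_mul2l le4.
by move=> /forallP H i; apply/esym/eqP.
Qed.

End Combinatorics.

(** * The character formula on the torus *)

Section Grouping.
Variables (F : numFieldType) (n : nat) (T : eqType).
Local Notation expo := {ffun 'I_n -> nat}.

Lemma mono_group (s : seq T) (c : T -> F) (k : T -> expo) z :
  \sum_(t <- s) c t * mono z (k t) =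
  \sum_(mu <- undup (map k s)) (\sum_(t <- s | k t == mu) c t) * mono z mu.
Proof.
under [RHS]eq_bigr do rewrite big_distrl big_mkcond /=.
rewrite exchange_big /= big_seq [RHS]big_seq; apply: eq_bigr => t ts.
rewrite (bigD1_seq (k t)) /= ?undup_uniq //; last by rewrite mem_undup map_f.
rewrite eqxx big1 ?addr0 // => mu /negPf muN.
by rewrite eq_sym muN.
Qed.

Lemma mono_coef0 (s : seq T) (c : T -> F) (k : T -> expo) :
  (forall z, nonzero z -> \sum_(t <- s) c t * mono z (k t) = 0) ->
  forall mu, \sum_(t <- s | k t == mu) c t = 0.
Proof.
move=> H mu; have [mus|muN] := boolP (mu \in undup (map k s)).
  apply: (mono_free (c := fun mu => \sum_(t <- s | k t == mu) c t) (undup_uniq _) _ mus).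
  by move=> z z0; rewrite -mono_group H.
rewrite big_seq_cond big1 // => t /andP[ts /eqP kt].
by rewrite mem_undup -kt map_f in muN.
Qed.

End Grouping.

Section TorusCharacter.
Variable F : numFieldType.
Variables (n N : nat) (e : 'I_N -> 'I_N -> pexp F ('I_n * 'I_n)).
Local Notation expo := {ffun 'I_n -> nat}.
Local Notation V := (pmx e).

Hypothesis pmx1 : V 1%:M = 1%:M.
Hypothesis pmxM : forall g h, V (g *m h) = V g *m V h.

Local Notation w m := (\tr (wproj e m)).

Definition expo_perm (m : expo) (p : 'S_n) : expo := [ffun i => m (p i)].

Lemma weights_pick (f : expo -> F) x :
  \sum_(m <- weights e | m == x) w m * f m = w x * f x.
Proof.
have [xw|xN] := boolP (x \in weights e).
  rewrite big_mkcond (bigD1_seq x) ?uniq_weights //= eqxx big1 ?addr0 //.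
  by move=> i /negPf->.
rewrite (wproj_out xN) mxtrace0 mul0r big_seq_cond big1 // => m /andP[mw /eqP mx].
by rewrite -mx mw in xN.
Qed.

(** Weyl invariance of the multiplicities: conjugation by a permutation matrix preserves the trace,
    so the coefficients of the two expansions agree. *)
Lemma mxtrace_wproj_perm m (p : 'S_n) : w (expo_perm m p) = w m.
Proof.
have trE (z : 'rV[F]_n) : \tr (V (diag_mx (\row_i z 0 (p i)))) = \tr (V (diag_mx z)).
  have -> : diag_mx (\row_i z 0 (p i)) = perm_mx p *m diag_mx z *m perm_mx p^-1.
    rewrite -row_permE -col_permE; apply/matrixP => i j; rewrite !mxE.
    by rewrite (inj_eq perm_inj).
  by rewrite !pmxM mxtrace_mulC mulmxA -pmxM -perm_mxM mulVg perm_mx1 pmx1 mul1mx.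
have monoE (z : 'rV[F]_n) k : mono (\row_i z 0 (p i)) k = mono z (expo_perm k p^-1).
  rewrite /mono (reindex_inj (@perm_inj _ p^-1)) /=; apply: eq_bigr => i _.
  by rewrite mxE ffunE permKV.
(* The tag separates the two expansions, so that their difference is a single sum of monomials. *)
pose s := [seq (true, m) | m <- weights e] ++ [seq (false, m) | m <- weights e].
pose c (t : bool * expo) := if t.1 then w t.2 else - w t.2.
pose k (t : bool * expo) := if t.1 then expo_perm t.2 p^-1 else t.2.
have H z : nonzero z -> \sum_(t <- s) c t * mono z (k t) = 0.
  move=> _; rewrite big_cat !big_map /=; under eq_bigr do rewrite -monoE.
  under [X in _ + X]eq_bigr do rewrite mulNr.
  by rewrite sumrN -!mxtrace_pmx_diag trE subrr.
have := mono_coef0 H m; rewrite big_cat !big_map /= sumrN => /eqP; rewrite subr_eq0.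
have -> : \sum_(j <- weights e | j == m) w j = w m.
  by rewrite -[RHS]mulr1 -(weights_pick (fun=> 1)); under [RHS]eq_bigr do rewrite mulr1.
have pE j : (expo_perm j p^-1 == m) = (j == expo_perm m p).
  by apply/eqP/eqP => [<-|->]; apply/ffunP => i; rewrite !ffunE ?permK ?permKV.
under eq_bigl do rewrite pE.
have -> : \sum_(j <- weights e | j == expo_perm m p) w j = w (expo_perm m p).
  by rewrite -[RHS]mulr1 -(weights_pick (fun=> 1)); under [RHS]eq_bigr do rewrite mulr1.
by move/eqP.
Qed.

Hypothesis irrV : forall W : {vspace 'cV[F]_N},
  {in unitmx, forall (g : 'M[F]_n) (w : 'cV[F]_N), w \in W -> V g *m w \in W} ->
  W = 0%VS \/ W = fullv.
Variables (l : expo) (v : 'cV[F]_N).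
Hypothesis v_neq0 : v != 0.
Hypothesis v_weight : forall z, nonzero z -> V (diag_mx z) *m v = mono z l *: v.
Hypothesis v_upper : forall u, lower_uni u^T -> V u *m v = v.
Hypothesis l_dominant : nonincreasing l.

Local Notation delta := (@staircase n).
Local Notation K := (\sum_i (l i + delta i)%:R ^+ 2 : F).
Local Notation D z := (alternant z delta).

Definition shifted (s : 'S_n) (m : expo) : expo := [ffun i => m i + delta (s i)]%N.

Lemma alternant_mono (z : 'rV[F]_n) :
  D z = \sum_(s : 'S_n) (-1) ^+ s * mono z [ffun i => delta (s i)].
Proof.
by apply: eq_bigr => s _; congr (_ * _); apply: eq_bigr => i _; rewrite ffunE.
Qed.

Lemma mono_shifted (z : 'rV[F]_n) s m :
  mono z (shifted s m) = mono z m * mono z [ffun i => delta (s i)].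
Proof. by rewrite -mono_add; congr mono; apply/ffunP => i; rewrite !ffunE. Qed.

(** Compute [D z] times the trace of [V(z) casimir] twice: by the Casimir scalar, and by
    [alternant_laplace], whose [n.-1] term cancels the linear term of [casimir]. What remains
    weights each monomial by its squared norm. *)
Lemma laplace_eigen (z : 'rV[F]_n) :
  \sum_(s : 'S_n) \sum_(m <- weights e) (-1) ^+ s * w m *
     (\sum_i (shifted s m i)%:R ^+ 2 - K) * mono z (shifted s m) = 0.
Proof.
pose Y i := \tr (V (diag_mx z) *m dpmx e (delta_mx i i)).
pose Q i := \tr (V (diag_mx z) *m dpmx e (delta_mx i i) *m dpmx e (delta_mx i i)).
pose kap : F := \sum_i (l i + delta i)%:R ^+ 2 - \sum_i (delta i)%:R ^+ 2.
have L := @alternant_laplace _ _ z (root_trace e z) Y (root_traceE pmx1 pmxM z).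
have trC : \tr (V (diag_mx z) *m casimir e) = \sum_i Q i +
    \sum_i \sum_(j | j != i) root_trace e z i j + n.-1%:R * \sum_i Y i.
  rewrite /casimir mulmxDr -scalemxAr raddfD /= mxtraceZ !mulmx_sumr !raddf_sum /=.
  rewrite -big_split /=; congr (_ + _); apply: eq_bigr => i _.
  rewrite mulmx_sumr raddf_sum (bigD1 i) //= mulmxA; congr (_ + _).
  by apply: eq_bigr => j _; rewrite mulmxA.
have E : D z * \tr (V (diag_mx z) *m casimir e) = D z * (kap * \tr (V (diag_mx z))).
  by rewrite (casimirE pmx1 pmxM irrV v_neq0 v_weight v_upper) mul_mx_scalar mxtraceZ.
rewrite trC !mulrDr L in E.
pose a (s : 'S_n) : F := (-1) ^+ s * mono z [ffun i => delta (s i)].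
pose b (m : expo) : F := w m * mono z m.
have DE : D z = \sum_s a s by exact: alternant_mono.
have XE : \tr (V (diag_mx z)) = \sum_(m <- weights e) b m by exact: mxtrace_pmx_diag.
have dDE i : dalternant z i = \sum_(s : 'S_n) (delta (s i))%:R * a s.
  apply: eq_bigr => s _; rewrite /a /mono mulrCA mulrA; congr (_ * _).
  by apply: eq_bigr => j _; rewrite ffunE.
have YE i : Y i = \sum_(m <- weights e) (m i)%:R * b m by exact: mxtrace_cartan.
have QE i : Q i = \sum_(m <- weights e) (m i)%:R ^+ 2 * b m by exact: mxtrace_cartan2.
have sqD (s : 'S_n) : \sum_(i < n) (delta i)%:R ^+ 2 = \sum_(i < n) (delta (s i))%:R ^+ 2 :> F.
  by rewrite [LHS](reindex_inj (@perm_inj _ s)).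
have T1 : D z * \sum_i Q i = \sum_(s : 'S_n) \sum_(m <- weights e) a s * b m * \sum_i (m i)%:R ^+ 2.
  rewrite DE mulr_suml; apply: eq_bigr => s _; rewrite mulr_sumr.
  under eq_bigr do rewrite QE mulr_sumr.
  rewrite exchange_big; apply: eq_bigr => m _; rewrite mulr_sumr.
  by apply: eq_bigr => i _ /=; rewrite mulrA mulrAC.
have T2 : \sum_i dalternant z i * Y i =
    \sum_(s : 'S_n) \sum_(m <- weights e) a s * b m * \sum_i (delta (s i))%:R * (m i)%:R.
  under eq_bigr => i _ do rewrite dDE YE mulr_suml.
  rewrite exchange_big; apply: eq_bigr => s _.
  under eq_bigr => i _ do rewrite mulr_sumr.
  rewrite exchange_big; apply: eq_bigr => m _; rewrite mulr_sumr.
  by apply: eq_bigr => i _ /=; ring.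
have T3 c : D z * (c * \tr (V (diag_mx z))) = \sum_(s : 'S_n) \sum_(m <- weights e) a s * b m * c.
  rewrite DE XE mulr_suml; apply: eq_bigr => s _; rewrite !mulr_sumr.
  by apply: eq_bigr => m _; ring.
transitivity (D z * (\sum_i Q i) + 2 * (\sum_i dalternant z i * Y i)
    - D z * (kap * \tr (V (diag_mx z)))); last by rewrite -E; ring.
rewrite T1 T2 T3 mulr_sumr -big_split -sumrB; apply: eq_bigr => s _ /=.
rewrite mulr_sumr -big_split -sumrB; apply: eq_bigr => m _ /=.
rewrite mono_shifted /kap (sqD s).
have -> : \sum_(i < n) (shifted s m i)%:R ^+ 2 = \sum_(i < n) (m i)%:R ^+ 2 +
    2 * (\sum_(i < n) (delta (s i))%:R * (m i)%:R) + \sum_(i < n) (delta (s i))%:R ^+ 2 :> F.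
  rewrite mulr_sumr -!big_split; apply: eq_bigr => i _ /=.
  by rewrite ffunE natrD; ring.
by rewrite /a /b; move: ((-1) ^+ s) => c; ring.
Qed.

Hypothesis wl : w l = 1.
Hypothesis dominated : forall m (d : 'I_n -> nat), nonincreasing d ->
  wproj e m != 0 -> (\sum_i d i * m i <= \sum_i d i * l i)%N.

(** By Weyl invariance all permutations of [m] are weights, hence dominated by [l]; so
    [dominated_norm_eq] applies to [m] with [s] undone. *)
Lemma shifted_norm_eq s m : w m != 0 ->
  \sum_i (shifted s m i)%:R ^+ 2 = K -> m = expo_perm l s.
Proof.
move=> wm normE; pose m' := expo_perm m s^-1.
have : m' =1 l.
  apply: dominated_norm_eq => // [p d hd|].
    have := dominated (m := expo_perm m (p * s^-1)%g) hd _.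
    under eq_bigr do rewrite ffunE permM.
    under [X in _ -> (X <= _)%N]eq_bigr do rewrite ffunE.
    apply; apply: contraNneq wm => A0.
    by rewrite -(mxtrace_wproj_perm m (p * s^-1)) A0 mxtrace0.
  rewrite (reindex_inj (@perm_inj _ s)) /=; apply/eqP.
  rewrite -(eqr_nat F) !natr_sum; apply/eqP; under [RHS]eq_bigr do rewrite natrX.
  by rewrite -normE; apply: eq_bigr => i _; rewrite !ffunE permK natrX.
by move=> H; apply/ffunP => i; rewrite ffunE -H ffunE permK.
Qed.

Theorem torus_character z : nonzero z ->
  \tr (V (diag_mx z)) * D z = alternant z (fun i => l i + delta i)%N.
Proof.
move=> z0; pose T := [seq (s, m) | s <- index_enum 'S_n, m <- weights e].
pose k (t : 'S_n * expo) := shifted t.1 t.2.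
pose c (t : 'S_n * expo) : F := (-1) ^+ t.1 * w t.2.
pose c' (t : 'S_n * expo) : F := if t.2 == expo_perm l t.1 then c t else 0.
pose sq (m : expo) : F := \sum_i (m i)%:R ^+ 2.
have big_T (f : 'S_n * expo -> F) :
    \sum_(t <- T) f t = \sum_s \sum_(m <- weights e) f (s, m).
  by rewrite big_allpairs.
have eigen mu : (sq mu - K) * \sum_(t <- T | k t == mu) c t = 0.
  transitivity (\sum_(t <- T | k t == mu) c t * (sq (k t) - K)).
    by rewrite mulr_sumr; apply: eq_bigr => t /eqP->; rewrite mulrC.
  apply: mono_coef0 => z' _; rewrite big_T -[RHS](laplace_eigen z').
  by apply: eq_bigr => s _; apply: eq_bigr.
(* [c'] keeps only the terms with [m = expo_perm l s]. If [mu] has norm [K], no other term has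
   nonzero multiplicity; otherwise both sums vanish. *)
have coefE mu : \sum_(t <- T | k t == mu) c t = \sum_(t <- T | k t == mu) c' t.
  have [norm|norm] := eqVneq (sq mu) K.
    apply: eq_bigr => -[s m] /eqP kt; rewrite /c' /c /=.
    case: eqP => // ne; have [->|wm] := eqVneq (w m) 0; first by rewrite mulr0.
    by case: ne; apply: shifted_norm_eq => //; rewrite -norm -kt.
  have /eqP := eigen mu; rewrite mulf_eq0 subr_eq0 (negPf norm) => /eqP->.
  rewrite big1 // => -[s m] /eqP kt; rewrite /c' /=; case: eqP => // mE.
  case/eqP: norm; rewrite -kt /sq mE [RHS](reindex_inj (@perm_inj _ s)) /=.
  by apply: eq_bigr => i _; rewrite !ffunE.
transitivity (\sum_(t <- T) c t * mono z (k t)).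
  rewrite big_T mulrC alternant_mono mulr_suml; apply: eq_bigr => s _.
  rewrite mxtrace_pmx_diag mulr_sumr; apply: eq_bigr => m _.
  by rewrite /c /k /= mono_shifted; move: ((-1) ^+ s) => a; ring.
rewrite mono_group; under eq_bigr do rewrite coefE; rewrite -mono_group big_T.
apply: eq_bigr => s _; rewrite /c' /c /k /=.
transitivity (\sum_(m <- weights e | m == expo_perm l s)
   w m * ((-1) ^+ s * mono z (shifted s m))).
  rewrite [RHS]big_mkcond; apply: eq_bigr => m _; case: eqP => _; last by rewrite mul0r.
  by rewrite mulrCA mulrA.
rewrite weights_pick mxtrace_wproj_perm wl mul1r; congr (_ * _).
by apply: eq_bigr => i _; rewrite !ffunE.
Qed.

End TorusCharacter.

(** * Polynomial functions and the twist by det *)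

Section PolynomialFunctions.
Variables (F : comNzRingType) (n : nat).
Local Notation M := 'M[F]_n.

Definition entries (g : M) (p : 'I_n * 'I_n) : F := g p.1 p.2.

Definition pexp_fun (f : M -> F) :=
  exists e : pexp F ('I_n * 'I_n), forall g, f g = peval id (entries g) e.

Lemma pexp_fun_const c : pexp_fun (fun=> c).
Proof. by exists (PConst _ c). Qed.

Lemma pexp_fun_entry i j : pexp_fun (fun g => g i j).
Proof. by exists (PVar (i, j)). Qed.

Lemma pexp_funD f f' : pexp_fun f -> pexp_fun f' -> pexp_fun (fun g => f g + f' g).
Proof. by move=> [e fE] [e' fE']; exists (PAdd e e') => g /=; rewrite fE fE'. Qed.

Lemma pexp_funM f f' : pexp_fun f -> pexp_fun f' -> pexp_fun (fun g => f g * f' g).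
Proof. by move=> [e fE] [e' fE']; exists (PMul e e') => g /=; rewrite fE fE'. Qed.

Lemma pexp_funX f k : pexp_fun f -> pexp_fun (fun g => f g ^+ k).
Proof.
move=> pf; elim: k => [|k IH]; first exact: pexp_fun_const.
by have [e eE] := pexp_funM pf IH; exists e => g; rewrite exprS eE.
Qed.

Lemma pexp_fun_sum (I : Type) (s : seq I) f : (forall i, pexp_fun (f i)) ->
  pexp_fun (fun g => \sum_(i <- s) f i g).
Proof.
move=> pf; elim: s => [|a s IH].
  by have [e eE] := pexp_fun_const 0; exists e => g; rewrite big_nil -eE.
by have [e eE] := pexp_funD (pf a) IH; exists e => g; rewrite big_cons eE.
Qed.

Lemma pexp_fun_prod (I : Type) (s : seq I) f : (forall i, pexp_fun (f i)) ->
  pexp_fun (fun g => \prod_(i <- s) f i g).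
Proof.
move=> pf; elim: s => [|a s IH].
  by have [e eE] := pexp_fun_const 1; exists e => g; rewrite big_nil -eE.
by have [e eE] := pexp_funM (pf a) IH; exists e => g; rewrite big_cons eE.
Qed.

Lemma pexp_fun_det : pexp_fun (fun g => \det g).
Proof.
apply: pexp_fun_sum => s; apply: pexp_funM; first exact: pexp_fun_const.
by apply: pexp_fun_prod => i; exact: pexp_fun_entry.
Qed.

End PolynomialFunctions.

Lemma polynomial_function_pexp (R : realType) (r : nat) (f : 'M[R[i]]_r.+1 -> R[i]) :
  polynomial_function f -> pexp_fun f.
Proof.
move=> [p pE]; pose u (k : 'I_(r.+1 * r.+1)) (g : 'M[R[i]]_r.+1) := mxvec g ord0 k.
have pu k : pexp_fun (u k).
  case: (mxvec_indexP k) => i j; have [e eE] := pexp_fun_entry R[i] i j.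
  by exists e => g; rewrite /u mxvecE eE.
have [e eE] : pexp_fun (fun g => mpoly.meval (u^~ g) p).
  have [e eE] : pexp_fun (fun g => \sum_(m <- mpoly.msupp p)
      mpoly.mcoeff m p * \prod_k u k g ^+ mpoly.fun_of_multinom m k).
    apply: pexp_fun_sum => m; apply: pexp_funM; first exact: pexp_fun_const.
    by apply: pexp_fun_prod => k; exact/pexp_funX/pu.
  by exists e => g; rewrite -eE mpoly.mevalE.
by exists e => g; rewrite pE -eE.
Qed.

(** * The twisted character as a polynomial class function *)

Section Core.
Variables (R : realType) (r : nat).
Local Notation C := R[i].
Local Notation M := 'M[C]_r.+1.
Local Notation delta := (@staircase r.+1).

(** [tau] is the trace of the polynomial representation [det^K V], whose highest weight is [l]. *)
Lemma irr_character_pexp (lam : 'I_r.+1 -> int) (chi : M -> C) :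
  dominant lam -> irr_character lam chi ->
  exists (K : nat) (l : 'I_r.+1 -> nat) (tau : M -> C),
  [/\ forall i, lam i + K%:Z = (l i)%:Z,
      pexp_fun tau,
      forall g, g \in unitmx -> tau g = \det g ^+ K * chi g,
      forall P g, P \in unitmx -> tau (P *m g *m invmx P) = tau g &
      forall z, nonzero z ->
        tau (diag_mx z) * alternant z delta = alternant z (fun i => l i + delta i)%N].
Proof.
move=> dom [N [V [[V1 VM] ratV [_ irrV] [v [v0 vw vu]] chiE]]].
have [f fP] := choice (fun p : 'I_N * 'I_N => ratV p.1 p.2).
have {fP}[k fP] := choice fP.
(* Large enough both to clear every denominator of [V] and to make every [lam i + K] nonnegative. *)
pose K := (\sum_p k p + \sum_i `|lam i|)%N.
have kK p : (k p <= K)%N by rewrite /K (bigD1 p) //= -!addnA leq_addr.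
have lamK i : 0 <= lam i + K%:Z.
  have : (`|lam i| <= K)%N by rewrite /K addnC (bigD1 i) //= -!addnA leq_addr.
  lia.
have pe p : pexp_fun (fun g : M => f p g * \det g ^+ (K - k p)).
  apply: pexp_funM; first by have [/polynomial_function_pexp] := fP p.
  exact/pexp_funX/pexp_fun_det.
have [e0 eE] := choice pe; pose e a b := e0 (a, b).
have pmxE g : g \in unitmx -> pmx e g = \det g ^+ K *: V g.
  move=> gu; apply/matrixP => a b; rewrite !mxE; have [_ ->//] := fP (a, b).
  have dg : \det g != 0 by rewrite -unitfE -unitmxE.
  rewrite -(eq_peval (h := id) (v := entries g)) // -eE /= mulrCA; congr (_ * _).
  by rewrite -[in RHS](subnK (kK (a, b))) exprD mulfK // expf_neq0.
have pmx1 : pmx e 1%:M = 1%:M.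
  by rewrite pmxE ?unitmx1 // det1 expr1n scale1r V1.
have pmxMu : {in unitmx &, forall g h, pmx e (g *m h) = pmx e g *m pmx e h}.
  move=> g h gu hu; rewrite !pmxE ?unitmx_mul ?gu ?hu // VM // det_mulmx exprMn.
  by rewrite -scalemxAl -scalemxAr scalerA.
have pM := pmxM pmxMu.
pose l : {ffun 'I_r.+1 -> nat} := [ffun i => absz (lam i + K%:Z)].
have lE i : lam i + K%:Z = (l i)%:Z by rewrite ffunE gez0_abs.
have irrP (W : {vspace 'cV[C]_N}) :
    {in unitmx, forall (g : M) (w : 'cV[C]_N), w \in W -> pmx e g *m w \in W} ->
    W = 0%VS \/ W = fullv.
  move=> HW; apply: irrV => g gu w wW; have := HW g gu w wW.
  rewrite pmxE // -scalemxAl => /(memvZ (\det g ^+ K)^-1).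
  by rewrite scalerA mulVf ?scale1r // expf_neq0 // -unitfE -unitmxE.
have diagu (z : 'rV[C]_r.+1) : nonzero z -> diag_mx z \in unitmx.
  by move=> z0; rewrite unitmxE det_diag unitfE; apply/prodf_neq0 => i _.
have vweight z : nonzero z -> pmx e (diag_mx z) *m v = mono z l *: v.
  move=> z0; rewrite pmxE ?diagu // -scalemxAl vw // scalerA det_diag; congr (_ *: v).
  rewrite -prodrXl -big_split; apply: eq_bigr => i _ /=.
  have := lE i; rewrite addrC => /(congr1 (fun a => z 0 i ^ a)).
  by rewrite expfzDr.
have vupper u : lower_uni u^T -> pmx e u *m v = v.
  move=> uu; have du := det_lower_uni uu; rewrite det_tr in du.
  rewrite pmxE; last by rewrite unitmxE du unitr1.
  rewrite du expr1n scale1r vu //; split; first exact: (proj1 uu).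
  by move=> i; have := proj2 uu i; rewrite mxE.
have ldom : nonincreasing l.
  by move=> i j ij; have := dom i j ij; have := lE i; have := lE j; lia.
have wl := highest_multiplicity pmx1 pM irrP v0 vweight vupper.
have wdom m d hd := weight_dominated pmx1 pM irrP v0 vweight vupper (m := m) (d := d) hd.
exists K, l, (fun g => \tr (pmx e g)); split=> //.
- apply: pexp_fun_sum => a; exists (e a a) => g.
  by rewrite mxE.
- by move=> g gu; rewrite pmxE // mxtraceZ chiE.
- move=> P g Pu; rewrite !pM mxtrace_mulC mulmxA -pM mulVmx // pmx1 mul1mx //.
- by move=> z; exact: (torus_character pmx1 pM irrP v0 vweight vupper ldom wl wdom).
Qed.

End Core.

(** * Wedges of matrix powers *)

Section Diagonalization.
Variables (F : numClosedFieldType) (r : nat).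
Local Notation M := 'M[F]_r.+1.

(** The minimal polynomial divides the characteristic one, which splits into distinct linear
    factors. *)
Lemma trig_diagonalizable (T : M) : is_trig_mx T -> injective (fun i => T i i) ->
  exists2 P : M, P \in unitmx & exists z, T = P *m diag_mx z *m invmx P.
Proof.
move=> trigT injT.
have [|P Pu] := (mxpoly.diagonalizableP T).2.
  exists [seq T i i | i : 'I_r.+1]; first by rewrite map_inj_uniq ?enum_uniq.
  rewrite big_image /= -char_poly_trig //; exact: mxminpoly_dvd_char.
move/(mxpoly.diagonalizable_forLR Pu) => [D ->].
exists (invmx P); first by rewrite unitmx_inv.
by exists D; rewrite mxpoly.conjumx ?unitmx_inv // invmxK.
Qed.

Lemma schur_trig (g : M) : exists2 P : M, P \in unitmx &
  exists2 T : M, is_trig_mx T & g = P *m T *m invmx P.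
Proof.
have [|P Pu /andP[gT _]] := @cotrigonalization2 F _ g g; first by [].
have Pun := unitarymx_unit Pu.
exists (invmx P); first by rewrite unitmx_inv.
exists (mxpoly.conjmx P g); first exact: gT.
by rewrite mxpoly.conjumx // invmxK !mulmxA mulVmx // mul1mx mulmxKV.
Qed.

(* Adding ['X * diag(1, 2, ...)] to a triangular form separates the eigenvalues. *)
Lemma generic_diagonalizable (g : M) :
  exists (G : 'M[{poly F}]_r.+1) (q : {poly F}), [/\ q != 0, evmx 0 G = g &
    forall x, q.[x] != 0 -> exists2 P : M, P \in unitmx &
      exists2 z, nonzero z & evmx x G = P *m diag_mx z *m invmx P].
Proof.
have [P Pu [T trigT ->]] := schur_trig g.
pose D : 'M[{poly F}]_r.+1 := map_mx polyC T + \matrix_(i, j) ('X *+ (i.+1 * (i == j))).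
have evD x : evmx x D = T + \matrix_(i, j) (x *+ (i.+1 * (i == j))).
  by apply/matrixP => i j; rewrite !mxE /horner_eval !hornerE hornerMn hornerX.
have trigD x : is_trig_mx (evmx x D).
  apply/is_trig_mxP => i j ij; rewrite evD !mxE (is_trig_mxP trigT) // add0r.
  by rewrite (_ : (i == j) = false) ?muln0 // -(inj_eq val_inj) /= ltn_eqF.
have evDd x i : evmx x D i i = T i i + x *+ i.+1.
  by rewrite evD !mxE eqxx muln1.
pose sep (p : 'I_r.+1 * 'I_r.+1) : {poly F} :=
  (T p.1 p.1 - T p.2 p.2)%:P + (p.1.+1%:R - p.2.+1%:R) *: 'X.
(* The first product keeps the eigenvalues distinct, the second keeps them nonzero. *)
pose q := (\prod_(p | p.1 != p.2) sep p) * \prod_i ((T i i)%:P + i.+1%:R *: 'X).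
have linN0 (a b : F) : b != 0 -> a%:P + b *: 'X != 0.
  move=> b0; apply/eqP => /(congr1 (fun p : {poly F} => p`_1)).
  by rewrite coefD coefC coefZ coefX /= add0r mulr1 coef0 => /eqP; rewrite (negPf b0).
exists (map_mx polyC P *m D *m map_mx polyC (invmx P)), q; split.
- rewrite mulf_neq0 //; first apply/prodf_neq0 => p ne.
    by rewrite linN0 // subr_eq0 eqr_nat eqSS (inj_eq val_inj).
  by apply/prodf_neq0 => i _; rewrite linN0 // pnatr_eq0.
- rewrite /evmx !map_mxM -!/(evmx _ _) !evmxC evD; congr (_ *m _ *m _).
  by apply/matrixP => i j; rewrite !mxE mul0rn addr0.
move=> x; rewrite hornerM mulf_eq0 negb_or !horner_prod => /andP[/prodf_neq0 q1 /prodf_neq0 q2].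
have [i j|Q Qu [z DE]] := @trig_diagonalizable (evmx x D) (trigD x).
  rewrite !evDd => eqd.
  apply/eqP/negPn/negP => ij; have := q1 (i, j) ij.
  rewrite /sep /= hornerD hornerC hornerZ hornerX => /negP; apply.
  rewrite mulrBl addrACA -opprD !mulr_natl subr_eq0.
  by apply/eqP.
exists (P *m Q); first by rewrite unitmx_mul Pu.
exists z.
  have dD : \det (evmx x D) != 0.
    rewrite det_trig //; apply/prodf_neq0 => i _; rewrite evDd.
    by have := q2 i isT; rewrite hornerD hornerC hornerZ hornerX mulr_natl.
  move: dD; rewrite DE !det_mulmx det_inv mulrAC mulfV ?mul1r; last first.
    by rewrite -unitfE -unitmxE.
  by rewrite det_diag => /prodf_neq0 zi i; exact: zi.
rewrite /evmx !map_mxM -!/(evmx _ _) !evmxC DE.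
have invPQ : invmx (P *m Q) = invmx Q *m invmx P.
  rewrite -[RHS]mulmx1 -(mulmxV (_ : P *m Q \in unitmx)) ?unitmx_mul ?Pu //.
  by rewrite mulmxA -[_ *m invmx P *m _]mulmxA mulKmx // mulVmx // mul1mx.
by rewrite invPQ !mulmxA.
Qed.

End Diagonalization.

(** * Coordinates of wedges and transfer from diagonalizable matrices *)

Section Wedge.
Variables (R : realType) (r : nat).
Local Notation C := R[i].
Local Notation M := 'M[C]_r.+1.

Lemma wedgeE (A : 'I_r.+1 -> M) f :
  wedge A f = \det (\matrix_(i, j) A j (f i).1 (f i).2).
Proof.
rewrite /wedge sum_ffunE; apply: eq_bigr => s _; rewrite !ffunE.
by congr (_ * _); apply: eq_bigr => i _; rewrite mxE.
Qed.

(** Right multiplication of every tensor factor by [B] is a linear map of the tensor power, written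
    in coordinates by [expand]. *)
Lemma wedge_mulr (c : C) (A A' : 'I_r.+1 -> M) (B : M) :
  wedge A = c *: wedge A' ->
  wedge (fun i => A i *m B) = c *: wedge (fun i => A' i *m B).
Proof.
have expand (D : 'I_r.+1 -> M) f : wedge (fun i => D i *m B) f =
    \sum_(h : {ffun 'I_r.+1 -> 'I_r.+1})
      (\prod_i B (h i) (f i).2) * wedge D [ffun i => ((f i).1, h i)].
  rewrite wedgeE; under [RHS]eq_bigr do rewrite wedgeE mulr_sumr.
  rewrite exchange_big; apply: eq_bigr => s _ /=.
  under eq_bigr do rewrite !mxE.
  rewrite bigA_distr_bigA mulr_sumr; apply: eq_bigr => h _ /=.
  rewrite mulrCA; congr (_ * _); rewrite big_split mulrC /=; congr (_ * _).
  by apply: eq_bigr => i _; rewrite !mxE ffunE.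
move=> H; apply/ffunP => f; rewrite expand [in RHS]ffunE expand.
rewrite scaler_sumr; apply: eq_bigr => h _.
by rewrite H ffunE scalerAr.
Qed.

Lemma wedge_mulr_eq (c : C) (A A' D D' : 'I_r.+1 -> M) (B : M) :
  wedge A = c *: wedge A' ->
  (forall i, D i = A i *m B) -> (forall i, D' i = A' i *m B) ->
  wedge D = c *: wedge D'.
Proof. by move=> AA' /funext-> /funext->; exact: wedge_mulr. Qed.

Lemma conj_diag_exp (P : M) (z : 'rV[C]_r.+1) k : P \in unitmx ->
  (P *m diag_mx z *m invmx P) ^+ k = P *m diag_mx (\row_i z 0 i ^+ k) *m invmx P.
Proof.
move=> Pu; elim: k => [|k IH].
  rewrite expr0 (_ : \row_i _ = const_mx 1); last by apply/rowP => i; rewrite !mxE.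
  by rewrite diag_const_mx mulmx1 mulmxV.
rewrite exprS IH -[_ * _]/(_ *m _) !mulmxA mulmxKV // -[P *m _ *m diag_mx _]mulmxA.
rewrite mulmx_diag; congr (_ *m diag_mx _ *m _).
by apply/rowP => i; rewrite !mxE exprS.
Qed.

Lemma wedge_conj_diag (P : M) (z : 'rV[C]_r.+1) (b : 'I_r.+1 -> nat) f : P \in unitmx ->
  wedge (fun i => (P *m diag_mx z *m invmx P) ^+ b i) f =
  \det (\matrix_(i, j) (P (f i).1 j * invmx P j (f i).2)) * alternant z b.
Proof.
move=> Pu; rewrite wedgeE alternantE -det_mulmx; congr (\det _).
apply/matrixP => i j; rewrite !mxE conj_diag_exp // !mxE; apply: eq_bigr => k _.
by rewrite mul_mx_diag !mxE; ring.
Qed.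

(** Both sides are polynomial along a curve through [g] whose generic points are invertible and
    diagonalizable; there the factor depending on [P] is common and the alternants decide. *)
Lemma wedge_density (f : M -> C) (b d : 'I_r.+1 -> nat) : pexp_fun f ->
  (forall P z, P \in unitmx -> nonzero z ->
     f (P *m diag_mx z *m invmx P) * alternant z b = alternant z d) ->
  forall g, wedge (fun i => g ^+ d i) = f g *: wedge (fun i => g ^+ b i).
Proof.
move=> [e fE] H g; apply/ffunP => phi; rewrite [in RHS]ffunE.
have [G [q [q0 <- Gdiag]]] := generic_diagonalizable g.
pose W (c : 'I_r.+1 -> nat) := \det (\matrix_(i, j) (G ^+ c j) (phi i).1 (phi i).2).
have WE c x : (W c).[x] = wedge (fun i => (evmx x G) ^+ c i) phi.
  rewrite wedgeE -[LHS]/(horner_eval x _) -det_map_mx; congr (\det _).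
  by apply/matrixP => i j; rewrite !mxE /evmx -rmorphXn !mxE.
pose p := peval polyC (fun t => G t.1 t.2) e.
have pE x : p.[x] = f (evmx x G).
  rewrite fE -[LHS]/(horner_eval x _) (peval_rmorph (horner_eval x)).
  by apply: eq_peval => [c|t] /=; rewrite ?/entries ?mxE // /horner_eval hornerC.
have /eqP : W d - p * W b = 0.
  apply: poly_eq0_generic q0 _ => x /Gdiag[P Pu [z z0 Gx]].
  rewrite hornerD hornerN hornerM !WE pE Gx !wedge_conj_diag //.
  by rewrite -(H P z) // mulrCA subrr.
rewrite subr_eq0 => /eqP/(congr1 (fun s => s.[0])).
by rewrite hornerM !WE pE.
Qed.

End Wedge.

(** * The matrix exponential *)

(** The binomial theorem, regrouped over the triangle [i + j < n]. [T] will be an entry of the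
    powers of a matrix, or 1 for the real majorant. *)
Lemma exp_triangle (K : numFieldType) (T : nat -> K) (a b : K) (n : nat) :
  \sum_(k < n) (k`!%:R)^-1 * (a + b) ^+ k * T k =
  \sum_(i < n) \sum_(j < n | (i + j < n)%N)
    (i`!%:R)^-1 * a ^+ i * ((j`!%:R)^-1 * b ^+ j) * T (i + j)%N.
Proof.
pose f (i j : nat) := (i`!%:R)^-1 * a ^+ i * ((j`!%:R)^-1 * b ^+ j) * T (i + j)%N.
transitivity (\sum_(k < n) \sum_(i < n | (i <= k)%N) f i (k - i)%N).
  apply: eq_bigr => k _; rewrite addrC exprDn mulr_sumr mulr_suml.
  rewrite (big_ord_widen n (fun i => k`!%:R^-1 * (b ^+ (k - i) * a ^+ i *+ 'C(k, i)) * T k)) //.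
  apply: eq_bigr => i ik; rewrite /f subnKC //; congr (_ * _).
  have fact_neq0 j : j`!%:R != 0 :> K by rewrite pnatr_eq0 -lt0n fact_gt0.
  rewrite -mulr_natr -(bin_fact (ik : (i <= k)%N)) !natrM.
  have binN0 : 'C(k, i)%:R != 0 :> K by rewrite pnatr_eq0 -lt0n bin_gt0.
  by field; rewrite !fact_neq0 binN0.
transitivity (\sum_(i < n) \sum_(j < n) \sum_(k < n | (k == i + j :> nat)%N) f i j); last first.
  apply: eq_bigr => i _; rewrite [RHS]big_mkcond; apply: eq_bigr => j _.
  case: ifP => ijn; last first.
    by rewrite big1 // => k /eqP kE; rewrite -kE ltn_ord in ijn.
  by rewrite (big_pred1 (Ordinal ijn)).
rewrite (exchange_big_dep xpredT) //=; apply: eq_bigr => i _.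
rewrite (exchange_big_dep xpredT) //= big_mkcond /=; apply: eq_bigr => k _.
case: ifP => ik; last first.
  by rewrite big1 // => j /eqP kE; rewrite kE leq_addr in ik.
have kin : (k - i < n)%N by rewrite (leq_ltn_trans (leq_subr _ _)).
rewrite (big_pred1 (Ordinal kin)) // => j /=.
by apply/eqP/eqP => [kE|->]; [apply/val_inj; rewrite /= kE addKn|rewrite /= subnKC].
Qed.

(** * Complex limits through real and imaginary parts *)

Section ComplexLimits.
Import Normc.
Import numFieldNormedType.Exports.
Local Open Scope classical_set_scope.
Variable R : realType.
Local Notation C := (Num.NumField.sort (complex_complex__canonical__Num_NumField R)).
Local Notation cRe := (@complex.Re R).
Local Notation cIm := (@complex.Im R).

Lemma normCE (x : C) : `|x| = (normc x)%:C. Proof. by []. Qed.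

Lemma normc_real (x : R) : normc x%:C = `|x|.
Proof. by rewrite /= expr0n addr0 sqrtr_sqr. Qed.

Lemma normcD (x y : C) : normc (x + y) <= normc x + normc y.
Proof. by rewrite -lecR rmorphD -!normCE ler_normD. Qed.

Lemma normc_sum (I : Type) (s : seq I) (P : pred I) (f : I -> C) :
  normc (\sum_(i <- s | P i) f i) <= \sum_(i <- s | P i) normc (f i).
Proof.
elim/big_rec2: _ => [|i y x _ IH]; first by rewrite normc0.
by rewrite (le_trans (normcD _ _)) // lerD2l.
Qed.

Lemma cvg_complex (u : nat -> C) (l : C) :
  (fun k => cRe (u k)) @ \oo --> cRe l -> (fun k => cIm (u k)) @ \oo --> cIm l ->
  u @ \oo --> l.
Proof.
move=> /cvgrPdist_lt uRe /cvgrPdist_lt uIm; apply/cvgrPdist_lt => eps eps0.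
have epsE : eps = (cRe eps)%:C by rewrite RRe_real // gtr0_real.
have e0 : 0 < cRe eps / 2 by rewrite divr_gt0 // -ltcR -epsE.
near=> k; rewrite epsE normCE ltcR.
have hRe : `|cRe l - cRe (u k)| < cRe eps / 2 by near: k; exact: uRe.
have hIm : `|cIm l - cIm (u k)| < cRe eps / 2 by near: k; exact: uIm.
have -> : l - u k = (cRe l - cRe (u k))%:C + 'i%C * (cIm l - cIm (u k))%:C.
  by rewrite [in LHS](complexE l) [in LHS](complexE (u k)) !rmorphB /=; ring.
rewrite (le_lt_trans (normcD _ _)) // normcM !normc_real.
have -> : normc 'i%C = 1 :> R by rewrite /= expr0n expr1n add0r sqrtr1.
by rewrite mul1r [cRe eps]splitr ltrD.
Unshelve. all: by end_near. Qed.

Lemma cvg_normc0 (u : nat -> C) (v : nat -> R) :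
  (forall k, normc (u k) <= v k) -> v @ \oo --> (0 : R) -> u @ \oo --> (0 : C).
Proof.
move=> uv /cvgr0Pnorm_lt v0; apply/cvgr0Pnorm_lt => eps eps0.
have epsE : eps = (cRe eps)%:C by rewrite RRe_real // gtr0_real.
have e0 : 0 < cRe eps by rewrite -ltcR -epsE.
near=> k; rewrite epsE normCE ltcR (le_lt_trans (uv k)) //.
by rewrite (le_lt_trans (ler_norm _)) //; near: k; exact: v0.
Unshelve. all: by end_near. Qed.

Lemma is_cvg_complex_series (c : nat -> C) (b : R) :
  (forall k, normc (c k) <= exp_coeff b k) -> 0 <= b ->
  exists l : C, (fun n => \sum_(k < n) c k) @ \oo --> l.
Proof.
move=> cb b0.
have part (p : C -> R) : p 0 = 0 -> {morph p : x y / x + y} ->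
    (forall x, `|p x| <= normc x) ->
    exists l : R, (fun n => p (\sum_(k < n) c k)) @ \oo --> l.
  move=> p0 pD pn.
  have /cvg_ex[l lP] : cvgn (series (p \o c)).
    apply: normed_cvg; apply: (@series_le_cvg _ _ (exp_coeff b)).
    - by move=> k; exact: normr_ge0.
    - by move=> k; exact: exp_coeff_ge0.
    - by move=> k /=; rewrite (le_trans (pn _)).
    - exact: is_cvg_series_exp_coeff.
  exists l; apply: cvg_trans lP; apply: near_eq_cvg; near=> n.
  by rewrite /series /= big_mkord (big_morph p pD p0).
have ReD : {morph cRe : x y / x + y} by case=> ? ? [].
have ImD : {morph cIm : x y / x + y} by case=> ? ? [].
have leRe x : `|cRe x| <= normc x.
  by case: x => x y; rewrite -sqrtr_sqr ler_wsqrtr // lerDl sqr_ge0.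
have leIm x : `|cIm x| <= normc x.
  by case: x => x y; rewrite -sqrtr_sqr ler_wsqrtr // lerDr sqr_ge0.
have [a aP] := part cRe erefl ReD leRe; have [a' aP'] := part cIm erefl ImD leIm.
by exists (a +i* a'); apply: cvg_complex.
Unshelve. all: by end_near. Qed.

End ComplexLimits.

(** * Convergence and additivity of the matrix exponential *)

Section MatrixExponential.
Import Normc.
Import numFieldNormedType.Exports.
Local Open Scope classical_set_scope.
Variables (R : realType) (r : nat).
Local Notation C := (Num.NumField.sort (complex_complex__canonical__Num_NumField R)).
Local Notation M := 'M[C]_r.+1.

Lemma cvg_mx_entries (u : nat -> M) (L : M) :
  (forall p q, (fun k => u k p q) @ \oo --> L p q) -> u @ \oo --> L.
Proof.
move=> H; apply/cvg_mx_entourageP => A entA.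
have : \forall N \near \oo, forall ij : 'I_r.+1 * 'I_r.+1, A (L ij.1 ij.2, u N ij.1 ij.2).
  by apply: filter_forall => -[i j]; exact: (cvg_entourageP _ _).1 (H i j) A entA.
by apply: filterS => N HN i j; rewrite inE; exact: (HN (i, j)).
Qed.

Lemma cvg_entry (u : nat -> M) (L : M) p q :
  u @ \oo --> L -> (fun k => u k p q) @ \oo --> L p q.
Proof.
move=> uL; have := @coord_continuous _ r.+1 r.+1 p q L.
exact: cvg_comp.
Qed.

Definition expsum (X : M) (n : nat) : M := \sum_(k < n) (k`!%:R)^-1 *: X ^+ k.

(** The factor [r.+1] counts the terms in an entry of a product, so that powers of this bound
    control the entries of powers of [X]. *)
Definition mxbound (X : M) : R := r.+1%:R * \sum_p \sum_q normc (X p q).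

Lemma mxbound_ge0 X : 0 <= mxbound X.
Proof.
rewrite mulr_ge0 // sumr_ge0 // => p _; rewrite sumr_ge0 // => q _.
by rewrite -lecR -normCE normr_ge0.
Qed.

Lemma normc_exp_entry (X : M) k p q : normc ((X ^+ k) p q) <= mxbound X ^+ k.
Proof.
have nge0 (x : C) : 0 <= normc x by rewrite -lecR -normCE normr_ge0.
have Xle p' q' : normc (X p' q') <= \sum_p \sum_q normc (X p q).
  rewrite (bigD1 p') //= (bigD1 q') //= -addrA lerDl addr_ge0 ?sumr_ge0 //.
  by move=> i _; rewrite sumr_ge0.
elim: k p q => [|k IH] p q.
  by rewrite !expr0 !mxE; case: eqP => _; rewrite ?normc1 ?normc0 ?ler01.
rewrite exprS mxE (le_trans (normc_sum _ _ _)) //.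
rewrite (@le_trans _ _ (\sum_(s < r.+1) (\sum_p \sum_q normc (X p q)) * mxbound X ^+ k)) //.
  by apply: ler_sum => s _; rewrite normcM ler_pM.
by rewrite sumr_const card_ord exprS -mulr_natl mulrA.
Qed.

Lemma normc_inv_fact k : normc ((k`!%:R)^-1 : C) = (k`!%:R)^-1.
Proof.
have -> : (k`!%:R : C) = (k`!%:R)%:C by rewrite rmorph_nat.
by rewrite normcV normc_real ger0_norm.
Qed.

Lemma normc_exp (a : C) k : normc (a ^+ k) = normc a ^+ k.
Proof. by elim: k => [|k IH]; rewrite ?normc1 // !exprS normcM IH. Qed.

(** Each entry is dominated by a real exponential series; this convergence gives meaning to the
    [limn] in [mexp]. *)
Lemma expsum_mexp X : expsum X @ \oo --> (mexp X : M).
Proof.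
have [L LP] : exists L : M, expsum X @ \oo --> L.
  have H pq : exists l : C, (fun n => \sum_(k < n) ((k`!%:R)^-1 *: X ^+ k : M) pq.1 pq.2) @ \oo --> l.
    apply: (@is_cvg_complex_series _ (fun k => ((k`!%:R)^-1 *: X ^+ k : M) pq.1 pq.2)
      (mxbound X)); last exact: mxbound_ge0.
    move=> k; rewrite mxE normcM normc_inv_fact /exp_coeff /= mulrC.
    by rewrite ler_wpM2r ?invr_ge0 // normc_exp_entry.
  have [l lP] := choice H.
  exists (\matrix_(p, q) l (p, q)); apply: cvg_mx_entries => p q; rewrite mxE.
  apply: cvg_trans (lP (p, q)); apply: near_eq_cvg; near=> n.
  by rewrite /expsum summxE.
have serE : series (fun k : nat => (k`!%:R : C)^-1 *: X ^+ k) = expsum X.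
  by apply/funext => n; rewrite /series /= big_mkord.
suff -> : mexp X = L by [].
rewrite /mexp serE; apply: (cvg_lim (@norm_hausdorff _ M) LP).
Unshelve. all: by end_near. Qed.

(** The product of the partial sums minus the partial sum for [a + b] is a sum over [i, j < n] with
    [i + j >= n]. It is bounded by the same difference for real exponentials, which tends to 0 by
    [expRD]. *)
Lemma mexpZD (X : M) (a b : C) :
  mexp ((a + b) *: X) = mexp (a *: X) *m mexp (b *: X).
Proof.
pose e (x : R) n := \sum_(k < n) exp_coeff x k.
have eE x : e x @ \oo --> expR x.
  have := is_cvg_series_exp_coeff x; rewrite -/(expR x) => cv.
  rewrite (_ : e x = series (exp_coeff x)) //.
  by apply/funext => n; rewrite /series /= big_mkord.
pose c := mxbound X; pose A := normc a; pose B := normc b.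
pose D n := expsum (a *: X) n *m expsum (b *: X) n - expsum ((a + b) *: X) n.
apply/esym/eqP; rewrite -subr_eq0; apply/eqP/matrixP => p q; rewrite [RHS]mxE.
have D0 : (fun n => D n p q) @ \oo --> (0 : C).
  apply: (@cvg_normc0 _ _ (fun n => e (A * c) n * e (B * c) n - e (A * c + B * c) n)).
    move=> n; pose T k : C := (X ^+ k) p q; pose u (k : nat) : C := (k`!%:R)^-1.
    have splitn (K : zmodType) (f : nat -> nat -> K) :
        \sum_(i < n) \sum_(j < n) f i j - \sum_(i < n) \sum_(j < n | (i + j < n)%N) f i j =
        \sum_(i < n) \sum_(j < n | (n <= i + j)%N) f i j.
      rewrite -sumrB; apply: eq_bigr => i _.
      rewrite [X in X - _](bigID (fun j : 'I_n => (i + j < n)%N)) /= addrAC subrr add0r.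
      by apply: eq_bigl => j; rewrite -leqNgt.
    have -> : D n p q = \sum_(i < n) \sum_(j < n | (n <= i + j)%N)
        u i * a ^+ i * (u j * b ^+ j) * T (i + j)%N.
      rewrite -(splitn _ (fun i j => u i * a ^+ i * (u j * b ^+ j) * T (i + j)%N)).
      rewrite -exp_triangle /D mxE [X in _ + X]mxE; congr (_ - _); last first.
        rewrite summxE; apply: eq_bigr => k _.
        by rewrite exprZn scalerA mxE.

      rewrite /expsum mulmx_suml summxE; apply: eq_bigr => i _.
      rewrite mulmx_sumr summxE; apply: eq_bigr => j _.
      rewrite !exprZn !scalerA -scalemxAl -scalemxAr scalerA mxE.
      by rewrite /T exprD.
    have -> : e (A * c) n * e (B * c) n - e (A * c + B * c) n =
        \sum_(i < n) \sum_(j < n | (n <= i + j)%N)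
        (i`!%:R)^-1 * (A * c) ^+ i * ((j`!%:R)^-1 * (B * c) ^+ j).
      rewrite -(splitn _ (fun i j => (i`!%:R)^-1 * (A * c) ^+ i * ((j`!%:R)^-1 * (B * c) ^+ j))).
      congr (_ - _).
        rewrite /e mulr_suml; apply: eq_bigr => i _; rewrite mulr_sumr.
        by apply: eq_bigr => j _; rewrite /exp_coeff /= ![_ / _]mulrC.
      have := exp_triangle (fun=> 1) (A * c) (B * c) n.
      under eq_bigr do rewrite mulr1; under [RHS]eq_bigr do under eq_bigr do rewrite mulr1.
      by move=> <-; apply: eq_bigr => k _; rewrite /exp_coeff /= mulrC.
    rewrite (le_trans (normc_sum _ _ _)) // ler_sum // => i _.
    rewrite (le_trans (normc_sum _ _ _)) // ler_sum // => j _.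
    rewrite !normcM !normc_inv_fact !normc_exp -/A -/B.
    rewrite [(A * c) ^+ i]exprMn [(B * c) ^+ j]exprMn [leRHS](_ : _ = i`!%:R^-1 * A ^+ i * (j`!%:R^-1 * B ^+ j) * c ^+ (i + j)).
      have nge0 (x : C) : 0 <= normc x by rewrite -lecR -normCE normr_ge0.
      by rewrite ler_wpM2l ?normc_exp_entry // !mulr_ge0 ?invr_ge0 ?exprn_ge0 ?ler0n ?nge0.
    by rewrite exprD; ring.
  rewrite -(subrr (expR (A * c + B * c))) {1}expRD.
  by apply: cvgB; [apply: cvgM|]; exact: eE.
apply: (cvg_unique (@norm_hausdorff _ C)) D0.
have -> : (fun n => D n p q) = (fun n => \sum_s expsum (a *: X) n p s * expsum (b *: X) n s q
    - expsum ((a + b) *: X) n p q).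
  by apply/funext => n; rewrite !mxE.
have H Y p' q' : (fun n => expsum Y n p' q') @ \oo --> ((mexp Y : M) p' q' : C).
  by apply: cvg_entry; exact: expsum_mexp.
rewrite !mxE; apply: cvgB; last exact: H.
apply: cvg_big => [|s _]; first exact: add_continuous.
by apply: cvgM; exact: H.
Qed.

End MatrixExponential.

(** * The identities *)

Section ComplexPowers.
Variables (R : realType) (r : nat) (g X : 'M[R[i]]_r.+1).
Hypotheses (gu : g \in unitmx) (Xg : is_log X g).

Lemma cpowD a b : cpow X (a + b) = cpow X a *m cpow X b.
Proof. exact: mexpZD. Qed.

Lemma cpow1 : cpow X 1 = g.
Proof. by rewrite /cpow scale1r. Qed.

Lemma cpow0 : cpow X 0 = 1%:M.
Proof.
have := cpowD 1 0; rewrite addr0 cpow1 => /(congr1 (mulmx (invmx g))).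
by rewrite mulVmx // mulKmx.
Qed.

Lemma cpow_nat n : cpow X n%:R = g ^+ n.
Proof.
elim: n => [|n IH]; first by rewrite cpow0.
by rewrite mulrS cpowD IH cpow1 exprS.
Qed.

Lemma cpow_int (m : int) : cpow X m%:~R = g ^ m.
Proof.
case: m => n; first exact: cpow_nat.
rewrite NegzE rmorphN /= -exprnN.
have gnu : g ^+ n.+1 \is a GRing.unit by rewrite unitrX.
have : g ^+ n.+1 * cpow X (- n.+1%:R) = 1.
  by rewrite -cpow_nat -[_ * _]/(_ *m _) -cpowD subrr cpow0.
by move/(congr1 (fun A => (g ^+ n.+1)^-1 * A)); rewrite mulKr // mulr1.
Qed.

End ComplexPowers.

Section Identities.
Variables (R : realType) (r : nat).
Local Notation C := R[i].
Local Notation M := 'M[C]_r.+1.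
Local Notation delta := (@staircase r.+1).

Lemma alternant_shift (z : 'rV[C]_r.+1) K (d : 'I_r.+1 -> nat) :
  alternant z (fun i => K + d i)%N = (\prod_i z 0 i) ^+ K * alternant z d.
Proof.
rewrite mulr_sumr; apply: eq_bigr => s _; rewrite mulrCA; congr (_ * _).
by rewrite -prodrXl -big_split; apply: eq_bigr => i _; rewrite exprD.
Qed.

Lemma det_conj_diag (P : M) z : P \in unitmx ->
  \det (P *m diag_mx z *m invmx P) = \prod_i z 0 i.
Proof.
move=> Pu; rewrite !det_mulmx mulrAC -det_mulmx mulmxV // det1 mul1r.
exact: det_diag.
Qed.

(** The identity for the character [det^K], from the same density principle. *)
Lemma wedge_shift (g : M) K (d : 'I_r.+1 -> nat) :
  wedge (fun i => g ^+ (K + d i)) = \det g ^+ K *: wedge (fun i => g ^+ d i).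
Proof.
apply: (wedge_density (f := fun g => \det g ^+ K)).
  exact/pexp_funX/pexp_fun_det.
by move=> P z Pu z0; rewrite det_conj_diag // alternant_shift.
Qed.

Variables (lam : 'I_r.+1 -> int) (chi : M -> C).
Hypotheses (lam_dom : dominant lam) (chi_lam : irr_character lam chi).

(** The identity for [tau], with the factor [det^K] absorbed as a shift of the exponents by [K]. *)
Lemma wedge_character : exists (K : nat) (l : 'I_r.+1 -> nat),
  (forall i, lam i + K%:Z = (l i)%:Z) /\
  forall g, g \in unitmx ->
    wedge (fun i => g ^+ (l i + delta i)) =
    chi g *: wedge (fun i => g ^+ (K + delta i)).
Proof.
have [K [l [tau [lE ptau tauE tauJ tauD]]]] := irr_character_pexp lam_dom chi_lam.
exists K, l; split=> // g gu.
rewrite wedge_shift scalerA mulrC -tauE //.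
by apply: (wedge_density ptau) => P z Pu z0; rewrite tauJ ?tauD.
Qed.

(** Density is applied to [f] itself, so that singular [g] are covered; the power [det^K] is
    cancelled only at invertible diagonalizable points. *)
Lemma wedge_character_poly (f : M -> C) (l : 'I_r.+1 -> nat) :
  polynomial_function f -> {in unitmx, f =1 chi} ->
  (forall i, lam i = (l i)%:Z) ->
  forall g, wedge (fun i => g ^+ (l i + delta i)) = f g *: wedge (fun i => g ^+ delta i).
Proof.
move=> /polynomial_function_pexp pf fchi lamE.
have [K [l' [tau [lE _ tauE tauJ tauD]]]] := irr_character_pexp lam_dom chi_lam.
apply: wedge_density => // P z Pu z0.
have pz0 : \prod_i z 0 i != 0 by apply/prodf_neq0 => i _.
have Du : P *m diag_mx z *m invmx P \in unitmx.
  by rewrite unitmxE det_conj_diag // unitfE.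
apply: (mulfI (expf_neq0 K pz0)); rewrite fchi // -alternant_shift mulrA.
rewrite -(det_conj_diag z Pu) -tauE // tauJ // tauD //.
apply: eq_bigr => s _; congr (_ * _); apply: eq_bigr => i _; congr (_ ^+ _).
by have := lE (s i); rewrite lamE; lia.
Qed.

End Identities.

Theorem theorem1p1 (R : realType) (r : nat) (lam : 'I_r.+1 -> int)
    (lam_dominant : dominant lam)
    (chi : 'M[R[i]]_r.+1 -> R[i]) (chi_lam : irr_character lam chi) :
  [/\ forall g X : 'M[R[i]]_r.+1, g \in unitmx -> is_log X g ->
      forall t : R[i],
        \sum_(s : 'S_r.+1) (-1 : R[i]) ^+ s *:
            tens_cpow X (perm_coord s (fun i => (lam i)%:~R + rho_shift t i))
          = chi g *: \sum_(s : 'S_r.+1) (-1 : R[i]) ^+ s *: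
              tens_cpow X (perm_coord s (rho_shift t))
        /\
        wedge (fun i => cpow X ((lam i)%:~R + r%:R / 2 - i%:R + t))
          = chi g *: wedge (fun i => cpow X (r%:R / 2 - i%:R + t)),
      forall (t : R[i]) (m : 'I_r.+1 -> int),
        (forall i, rho_shift t i = (m i)%:~R) ->
      forall g X Y : 'M[R[i]]_r.+1, g \in unitmx -> is_log X g -> is_log Y g ->
      forall i,
        [/\ cpow X (rho_shift t i) = cpow Y (rho_shift t i),
            cpow X ((lam i)%:~R + rho_shift t i)
              = cpow Y ((lam i)%:~R + rho_shift t i),
            cpow X (rho_shift t i) = g ^ m i &
            cpow X ((lam i)%:~R + rho_shift t i) = g ^ (lam i + m i)],
      forall g : 'M[R[i]]_r.+1, g \in unitmx ->
        wedge (fun i => g ^ (lam i + r%:Z - i%:Z))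
          = chi g *: wedge (fun i => g ^ (r%:Z - i%:Z)) &
      forall (t : R[i]) (m : 'I_r.+1 -> int),
        (forall i, rho_shift t i = (m i)%:~R) ->
        (forall i, 0 <= m i) -> (forall i, 0 <= lam i) ->
      forall chiM : 'M[R[i]]_r.+1 -> R[i],
        polynomial_function chiM -> {in unitmx, chiM =1 chi} ->
      forall g : 'M[R[i]]_r.+1,
        \sum_(s : 'S_r.+1) (-1 : R[i]) ^+ s *:
            tens_ipow g (perm_coord s (fun i => lam i + m i))
          = chiM g *: \sum_(s : 'S_r.+1) (-1 : R[i]) ^+ s *:
              tens_ipow g (perm_coord s m)
        /\
        wedge (fun i => g ^ (lam i + m i))
          = chiM g *: wedge (fun i => g ^ m i)].
Proof.
have [K [l [lE HW]]] := wedge_character lam_dominant chi_lam.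
have deltaE (i : 'I_r.+1) : (staircase i)%:Z = r%:Z - i%:Z.
  by rewrite /staircase /=; have := ltn_ord i; lia.
have deltaC (i : 'I_r.+1) : (staircase i)%:R = r%:R - i%:R :> R[i].
  by rewrite /staircase natrB // -ltnS.
have lC i : (lam i)%:~R = (l i)%:R - K%:R :> R[i].
  have := congr1 (fun a : int => a%:~R : R[i]) (lE i).
  by rewrite rmorphD /= => E; rewrite -[(l i)%:R]/((l i)%:Z%:~R) -E addrK.
split.
(* Multiplying every factor by [B] turns the natural exponents [l i + r - i] and [K + r - i] into
   the required complex ones. *)
- move=> g X gu Xg t; pose B := cpow X (t - r%:R / 2 - K%:R).
  have shiftE (e : R[i]) k : k%:R + (t - r%:R / 2 - K%:R) = e -> cpow X e = g ^+ k *m B.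
    by move=> <-; rewrite -(cpow_nat gu Xg) -cpowD.
  have rhoE (i : 'I_r.+1) : rho_shift t i = r%:R / 2 - i%:R + t.
    by rewrite /rho_shift /rho; field.
  have W1 : wedge (fun i => cpow X ((lam i)%:~R + rho_shift t i)) =
      chi g *: wedge (fun i => cpow X (rho_shift t i)).
    apply: (wedge_mulr_eq (HW g gu)) => i; apply: shiftE.
      by rewrite rhoE natrD deltaC lC; field.
    by rewrite rhoE natrD deltaC; field.
  (* The alternating sum over permutations is the wedge by definition. *)
  split; first exact: W1.
  apply: (wedge_mulr_eq (HW g gu)) => i; apply: shiftE.
    by rewrite natrD deltaC lC; field.
  by rewrite natrD deltaC; field.
- move=> t m mE g X Y gu Xg Yg i; rewrite mE -rmorphD /=.
  by rewrite !(cpow_int gu Xg) !(cpow_int gu Yg).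
- move=> g gu; have gU : g \is a GRing.unit by [].
  have shiftE (e : int) k : k%:Z - K%:Z = e -> g ^ e = g ^+ k *m (g ^ (- K%:Z)).
    by move=> <-; rewrite exprzDr.
  apply: (wedge_mulr_eq (HW g gu)) => i; apply: shiftE.
    by rewrite PoszD deltaE -lE; lia.
  by rewrite PoszD deltaE; lia.
move=> t m mE m0 lam0 chiM pchi chiE g.
have W4 : wedge (fun i => g ^ (lam i + m i)) = chiM g *: wedge (fun i => g ^ m i).
  (* The smallest coordinate of [rho_t], equal to [t - r/2]. Being nonnegative, it allows
     multiplication by [g ^+ c] even for singular [g]. *)
  pose c := absz (m ord_max).
  have mD i : m i = (staircase i + c)%:Z.
    apply/eqP; rewrite -(eqr_int R[i]) -mE PoszD rmorphD /= gez0_abs // -mE.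
    rewrite -[(staircase i)%:~R]/((staircase i)%:R) deltaC /rho_shift /rho /=.
    by apply/eqP; field.
  have lamE i : lam i = (absz (lam i))%:Z by rewrite gez0_abs.
  have W := wedge_character_poly lam_dominant chi_lam pchi chiE lamE g.
  apply: (wedge_mulr_eq (B := g ^+ c) W) => i.
    by rewrite {1}lamE mD -PoszD addnA -[RHS]/(_ * _) -exprD.
  by rewrite mD -[RHS]/(_ * _) -exprD.
by split.
Qed.
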